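(* Let $X$ be a four-dimensional manifold with a flat torsionless affine connection $\nabla$ with coefficients $\Gamma^\rho{}_{\mu\nu}$, and let $g$ be a Lorentzian metric on $X$ of signature $(-,+,+,+)$. Put $Q_{\rho\mu\nu}=\nabla_\rho g_{\mu\nu}$, and let $\Pi$ be the STEGR momentum $$\Pi^{\rho\mu\nu}=-\frac{2\sqrt{-g}}{\kappa^2}\,\mathfrak P^{\rho\mu\nu},\qquad \mathfrak P^{\rho\mu\nu}=-\tfrac12 Q^{\rho\mu\nu}+\tfrac12 Q^{\mu\nu\rho}+\tfrac12 Q^{\nu\mu\rho}+\tfrac12(Q^\rho-\widetilde Q^\rho)g^{\mu\nu}-\tfrac14(g^{\rho\mu}Q^\nu+g^{\rho\nu}Q^\mu).$$ Then the Einstein tensor $\bar G^{\mu\nu}$ of the Levi-Civita connection of $g$ satisfies identically (without imposing any field equation) $$\sqrt{-g}\,\bar G^{\mu\nu}=-\frac{\kappa^2}{2}\nabla_\rho\Pi^{\rho\mu\nu}+\frac{\kappa^4}{\sqrt{-g}}\,\mathcal V^{\mu\nu}[\Pi,g],$$ where $$\begin{aligned} \mathcal V^{\mu\nu}[\Pi,g]={}&\tfrac14\Pi^{\alpha\mu\beta}\Pi_\beta{}^\nu{}_\alpha+\tfrac12\Pi^{(\mu|\alpha\beta|}\Pi_\alpha{}^{\nu)}{}_\beta+\tfrac1{24}\Pi^\mu\Pi^\nu-\tfrac1{12}\widetilde\Pi^\mu\widetilde\Pi^\nu-\tfrac16\Pi^{(\mu}\widetilde\Pi^{\nu)}\\ &+\tfrac1{12}\Pi_\alpha\Pi^{\alpha\mu\nu}-\tfrac16\widetilde\Pi_\alpha\Pi^{\alpha\mu\nu}-\tfrac16\Pi_\alpha\Pi^{(\mu\nu)\alpha}-\tfrac16\widetilde\Pi_\alpha\Pi^{(\mu\nu)\alpha}\\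 &+g^{\mu\nu}\left(-\tfrac18\Pi^{\rho\alpha\beta}\Pi_{\alpha\beta\rho}-\tfrac1{48}\Pi^\rho\Pi_\rho+\tfrac1{24}\widetilde\Pi^\rho\widetilde\Pi_\rho+\tfrac1{12}\Pi^\rho\widetilde\Pi_\rho\right). \end{aligned}$$ Equivalently, $$\nabla_\rho\Pi^{\rho\mu\nu}+\frac{\partial(\sqrt{-g}\,\mathcal H_{\rm STEGR})}{\partial g_{\mu\nu}}\bigg|_\Pi=-\frac{2}{\kappa^2}\sqrt{-g}\;\bar G^{\mu\nu},$$ so that the vacuum second Hamilton equation $\nabla_\rho\Pi^{\rho\mu\nu}=-\partial(\sqrt{-g}\,\mathcal H_{\rm STEGR})/\partial g_{\mu\nu}|_\Pi$ is identified with $\bar G_{\mu\nu}=0$.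
   Context: $\kappa^2>0$ is a constant; indices are moved with $g$; $A_{(\mu\nu)}=\tfrac12(A_{\mu\nu}+A_{\nu\mu})$, with indices between vertical bars excluded from the symmetrization. For a tensor (density) $Y_{\rho\mu\nu}=Y_{\rho\nu\mu}$, the traces are $Y_\rho=Y_{\rho\lambda}{}^\lambda$ and $\widetilde Y_\rho=Y_{\lambda\rho}{}^\lambda$. Connection convention (last lower index is the derivative slot): $\nabla_\mu V^\rho=\partial_\mu V^\rho+\Gamma^\rho{}_{\sigma\mu}V^\sigma$. Torsionless means $\Gamma^\rho{}_{\mu\nu}=\Gamma^\rho{}_{\nu\mu}$; flat means $R^\rho{}_{\sigma\mu\nu}=\partial_\mu\Gamma^\rho{}_{\sigma\nu}-\partial_\nu\Gamma^\rho{}_{\sigma\mu}+\Gamma^\rho{}_{\lambda\mu}\Gamma^\lambda{}_{\sigma\nu}-\Gamma^\rho{}_{\lambda\nu}\Gamma^\lambda{}_{\sigma\mu}=0$. The Levi-Civita curvature uses the same formula with the Christoffel symbols, $\bar R_{\sigma\nu}=\bar R^\rho{}_{\sigma\rho\nu}$, $\bar G_{\mu\nu}=\bar R_{\mu\nu}-\tfrac12 g_{\mu\nu}\bar R$. Since $\Pi^{\rho\mu\nu}$ is a weight-one tensor density, $\nabla_\rho\Pi^{\rho\mu\nu}=\partial_\rho\Pi^{\rho\mu\nu}+\Gamma^\mu{}_{\lambda\rho}\Pi^{\rho\lambda\nu}+\Gamma^\nu{}_{\lambda\rho}\Pi^{\rho\mu\lambda}$. The STEGR Hamiltonian density is $$\sqrt{-g}\,\mathcal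 H_{\rm STEGR}=-\frac{\kappa^2}{2\sqrt{-g}}\left(\Pi^{\rho\mu\nu}\Pi_{\mu\nu\rho}+\tfrac16\Pi^\mu\Pi_\mu-\tfrac23\Pi^\mu\widetilde\Pi_\mu-\tfrac13\widetilde\Pi^\mu\widetilde\Pi_\mu\right),$$ regarded as a function of $(g_{\mu\nu},\Pi^{\rho\mu\nu})$; the derivative $\partial/\partial g_{\mu\nu}|_\Pi$ is taken with the contravariant components $\Pi^{\rho\mu\nu}$ held fixed and is symmetric in $\mu\nu$ (defined by $\delta f=(\partial f/\partial g_{\mu\nu})\,\delta g_{\mu\nu}$ for symmetric $\delta g_{\mu\nu}$). *)

(* Defs.v *)
(* MathComp-Analysis. *)
From mathcomp Require Import all_boot all_order all_algebra.
From mathcomp Require Import all_classical all_reals all_analysis.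

Set Implicit Arguments.
Unset Strict Implicit.
Unset Printing Implicit Defensive.

Import Order.TTheory GRing.Theory Num.Theory.
Import numFieldNormedType.Exports.

Local Open Scope classical_set_scope.
Local Open Scope ring_scope.

(* Tensor fields are given by their components in the charts of an atlas, as   *)
(* functions of the coordinates x : 'rV[R]_4; only their values on the image   *)
(* of the chart are meaningful.  A term [tensor3 R] is an array of components  *)
(* at one point; which indices are up or down is said at each use.             *)

Definition tensor1 (R : Type) := 'I_4 -> R.
Definition tensor2 (R : Type) := 'I_4 -> 'I_4 -> R.
Definition tensor3 (R : Type) := 'I_4 -> 'I_4 -> 'I_4 -> R.

Definition partial (R : realType) (mu : 'I_4) (f : 'rV[R]_4 -> R)
    (x : 'rV[R]_4) : R :=
  'D_(delta_mx 0 mu) f x.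

(* All iterated partial derivatives are (Frechet) differentiable on the open   *)
(* set U, i.e. f is C^oo on U.                                                 *)
Definition smooth_on (R : realType) (U : set 'rV[R]_4) (f : 'rV[R]_4 -> R) :
    Prop :=
  forall (s : seq 'I_4) (x : 'rV[R]_4), U x ->
    differentiable (foldr (@partial R) f s) x.

Record manifold4 (R : realType) (X : topologicalType) := Manifold4 {
  chart_index : Type;
  chart_dom : chart_index -> set X;
  chart : chart_index -> X -> 'rV[R]_4;
  chart_inv : chart_index -> 'rV[R]_4 -> X;
  manifold_hausdorff : hausdorff_space X;
  manifold_countable : @second_countable X;
  chart_cover : forall p, exists i, chart_dom i p;
  chart_dom_open : forall i, open (chart_dom i);
  chart_cod_open : forall i, open (chart i @` chart_dom i);
  chartK : forall i p, chart_dom i p -> chart_inv i (chart i p) = p;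
  chart_continuous : forall i p, chart_dom i p ->
    {for p, continuous (chart i)};
  chart_inv_continuous : forall i p, chart_dom i p ->
    {for chart i p, continuous (chart_inv i)};
  transition_smooth : forall i j a,
    smooth_on (chart i @` (chart_dom i `&` chart_dom j))
      (fun x => chart j (chart_inv i x) 0 a) }.

Definition chart_cod (R : realType) (X : topologicalType) (M : manifold4 R X)
    (i : chart_index M) : set 'rV[R]_4 :=
  chart i @` chart_dom i.

Definition overlap (R : realType) (X : topologicalType) (M : manifold4 R X)
    (i j : chart_index M) : set 'rV[R]_4 :=
  chart i @` (chart_dom i `&` chart_dom j).

Definition transition (R : realType) (X : topologicalType) (M : manifold4 R X)
    (i j : chart_index M) (x : 'rV[R]_4) : 'rV[R]_4 :=
  chart j (chart_inv i x).

(* dy^a / dx^mu, with x the coordinates of chart i and y those of chart j. *)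
Definition transition_jacobian (R : realType) (X : topologicalType)
    (M : manifold4 R X) (i j : chart_index M) (a mu : 'I_4) (x : 'rV[R]_4) :
    R :=
  partial mu (fun z => transition i j z 0 a) x.

(* [connection_coef c i x rho sigma mu] is Gamma^rho_{sigma mu}, with mu the   *)
(* derivative slot.                                                            *)
Record connection (R : realType) (X : topologicalType) (M : manifold4 R X) :=
  Connection {
  connection_coef : chart_index M -> 'rV[R]_4 -> tensor3 R;
  connection_smooth : forall i rho sigma mu,
    smooth_on (chart_cod i) (fun x => connection_coef i x rho sigma mu);
  connection_law : forall i j x, overlap i j x -> forall a sigma mu,
    \sum_rho transition_jacobian i j a rho x * connection_coef i x rho sigma mu
    = \sum_b \sum_c connection_coef j (transition i j x) a b c
        * transition_jacobian i j b sigma x * transition_jacobian i j c mu x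
      + partial mu (transition_jacobian i j a sigma) x }.

(* Signature (-,+,+,+). *)
Definition lorentzian (R : realType) (g : 'M[R]_4) : Prop :=
  g^T = g /\
  exists P : 'M[R]_4, P \in unitmx /\
    P^T *m g *m P = diag_mx (\row_(i < 4) (if i == 0 then -1 else 1)).

Record lorentz_metric (R : realType) (X : topologicalType)
    (M : manifold4 R X) := LorentzMetric {
  metric_coef : chart_index M -> 'rV[R]_4 -> 'M[R]_4;
  metric_smooth : forall i mu nu,
    smooth_on (chart_cod i) (fun x => metric_coef i x mu nu);
  metric_lorentzian : forall i x, chart_cod i x -> lorentzian (metric_coef i x);
  metric_law : forall i j x, overlap i j x -> forall mu nu,
    metric_coef i x mu nu
    = \sum_a \sum_b transition_jacobian i j a mu x
        * transition_jacobian i j b nu x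
        * metric_coef j (transition i j x) a b }.

(* R^rho_{sigma mu nu} *)
Definition curvature (R : realType) (Gam : 'rV[R]_4 -> tensor3 R)
    (x : 'rV[R]_4) (rho sigma mu nu : 'I_4) : R :=
  partial mu (fun y => Gam y rho sigma nu) x
  - partial nu (fun y => Gam y rho sigma mu) x
  + \sum_lam Gam x rho lam mu * Gam x lam sigma nu
  - \sum_lam Gam x rho lam nu * Gam x lam sigma mu.

Definition torsionless (R : realType) (X : topologicalType)
    (M : manifold4 R X) (c : connection M) : Prop :=
  forall i x, chart_cod i x -> forall rho mu nu,
    connection_coef c i x rho mu nu = connection_coef c i x rho nu mu.

Definition flat (R : realType) (X : topologicalType)
    (M : manifold4 R X) (c : connection M) : Prop :=
  forall i x, chart_cod i x -> forall rho sigma mu nu,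
    curvature (connection_coef c i) x rho sigma mu nu = 0.

(* In what follows g is the matrix g_{mu nu} and invmx g is g^{mu nu}.  The    *)
(* functions move* below move indices with the matrix m: m = g lowers and      *)
(* m = invmx g raises; move3 acts on all three indices, move13 on the first    *)
(* and the third.  For indices of Y that are up, trace23 g and trace13 g are   *)
(* the traces Y^rho and tilde Y^rho; for indices that are down, trace23        *)
(* (invmx g) and trace13 (invmx g) are Y_rho and tilde Y_rho.                  *)

Definition move1 (R : realType) (m : 'M[R]_4) (V : tensor1 R) : tensor1 R :=
  fun a => \sum_b m a b * V b.

Definition move2 (R : realType) (m : 'M[R]_4) (T : tensor2 R) : tensor2 R :=
  fun a b => \sum_c \sum_d m a c * m b d * T c d.

Definition move3 (R : realType) (m : 'M[R]_4) (Y : tensor3 R) : tensor3 R :=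
  fun a b c => \sum_d \sum_e \sum_f m a d * m b e * m c f * Y d e f.

Definition move13 (R : realType) (m : 'M[R]_4) (Y : tensor3 R) : tensor3 R :=
  fun a b c => \sum_d \sum_f m a d * m c f * Y d b f.

Definition trace23 (R : realType) (m : 'M[R]_4) (Y : tensor3 R) : tensor1 R :=
  fun rho => \sum_lam \sum_k m lam k * Y rho lam k.

Definition trace13 (R : realType) (m : 'M[R]_4) (Y : tensor3 R) : tensor1 R :=
  fun rho => \sum_lam \sum_k m lam k * Y lam rho k.

Definition dot (R : realType) (V W : tensor1 R) : R := \sum_a V a * W a.

Definition symmetrize (R : realType) (T : tensor2 R) : tensor2 R :=
  fun mu nu => 2^-1 * (T mu nu + T nu mu).

(* sqrt (-g) *)
Definition vol (R : realType) (g : 'M[R]_4) : R := Num.sqrt (- \det g).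

Definition christoffel (R : realType) (g : 'rV[R]_4 -> 'M[R]_4)
    (x : 'rV[R]_4) : tensor3 R :=
  fun rho mu nu => 2^-1 * \sum_lam invmx (g x) rho lam *
    (partial mu (fun y => g y lam nu) x + partial nu (fun y => g y lam mu) x
     - partial lam (fun y => g y mu nu) x).

Definition ricci (R : realType) (g : 'rV[R]_4 -> 'M[R]_4) (x : 'rV[R]_4) :
    tensor2 R :=
  fun sigma nu => \sum_rho curvature (christoffel g) x rho sigma rho nu.

Definition scalar_curvature (R : realType) (g : 'rV[R]_4 -> 'M[R]_4)
    (x : 'rV[R]_4) : R :=
  \sum_mu \sum_nu invmx (g x) mu nu * ricci g x mu nu.

(* G_{mu nu} and G^{mu nu} *)
Definition einstein (R : realType) (g : 'rV[R]_4 -> 'M[R]_4) (x : 'rV[R]_4) :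
    tensor2 R :=
  fun mu nu => ricci g x mu nu - 2^-1 * g x mu nu * scalar_curvature g x.

Definition einstein_up (R : realType) (g : 'rV[R]_4 -> 'M[R]_4)
    (x : 'rV[R]_4) : tensor2 R :=
  move2 (invmx (g x)) (einstein g x).

(* Q_{rho mu nu} = nabla_rho g_{mu nu} *)
Definition nonmetricity (R : realType) (Gam : 'rV[R]_4 -> tensor3 R)
    (g : 'rV[R]_4 -> 'M[R]_4) (x : 'rV[R]_4) : tensor3 R :=
  fun rho mu nu => partial rho (fun y => g y mu nu) x
    - \sum_lam Gam x lam mu rho * g x lam nu
    - \sum_lam Gam x lam nu rho * g x mu lam.

(* P^{rho mu nu} as a function of g_{mu nu} and Q_{rho mu nu} *)
Definition superpotential (R : realType) (g : 'M[R]_4) (Q : tensor3 R) :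
    tensor3 R :=
  let gi := invmx g in
  let Qu := move3 gi Q in
  let q := move1 gi (trace23 gi Q) in
  let qt := move1 gi (trace13 gi Q) in
  fun rho mu nu =>
    - (2^-1 * Qu rho mu nu) + 2^-1 * Qu mu nu rho + 2^-1 * Qu nu mu rho
    + 2^-1 * (q rho - qt rho) * gi mu nu
    - 4^-1 * (gi rho mu * q nu + gi rho nu * q mu).

(* Pi^{rho mu nu} *)
Definition stegr_momentum (R : realType) (kappa : R)
    (Gam : 'rV[R]_4 -> tensor3 R) (g : 'rV[R]_4 -> 'M[R]_4) (x : 'rV[R]_4) :
    tensor3 R :=
  fun rho mu nu => - (2 * vol (g x) / kappa ^+ 2)
    * superpotential (g x) (nonmetricity Gam g x) rho mu nu.

(* nabla_rho Pi^{rho mu nu} for a tensor density Pi of weight one and a        *)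
(* torsionless connection: the terms from the index rho and from the weight    *)
(* cancel.                                                                     *)
Definition density_divergence (R : realType) (Gam : 'rV[R]_4 -> tensor3 R)
    (Pi : 'rV[R]_4 -> tensor3 R) (x : 'rV[R]_4) : tensor2 R :=
  fun mu nu =>
    \sum_rho partial rho (fun y => Pi y rho mu nu) x
    + \sum_rho \sum_lam Gam x mu lam rho * Pi x rho lam nu
    + \sum_rho \sum_lam Gam x nu lam rho * Pi x rho mu lam.

(* sqrt (-g) H_STEGR as a function of g_{mu nu} and Pi^{rho mu nu} *)
Definition stegr_hamiltonian (R : realType) (kappa : R) (g : 'M[R]_4)
    (Pi : tensor3 R) : R :=
  let Pd := move3 g Pi in
  let p := trace23 g Pi in
  let pt := trace13 g Pi in
  - (kappa ^+ 2 / (2 * vol g)) *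
    (\sum_rho \sum_mu \sum_nu Pi rho mu nu * Pd mu nu rho
     + 6^-1 * dot p (move1 g p)
     - 2 / 3 * dot p (move1 g pt)
     - 3^-1 * dot pt (move1 g pt)).

(* D^{mu nu} = df/dg_{mu nu} at g: the symmetric array such that               *)
(* delta f = D^{mu nu} delta g_{mu nu} for all symmetric delta g.              *)
Definition is_metric_derivative (R : realType) (f : 'M[R]_4 -> R)
    (g D : 'M[R]_4) : Prop :=
  D^T = D /\
  forall h : 'M[R]_4, h^T = h ->
    is_derive g h f (\sum_mu \sum_nu D mu nu * h mu nu).

(* V^{mu nu}[Pi, g] *)
Definition stegr_potential (R : realType) (Pi : tensor3 R) (g : 'M[R]_4) :
    tensor2 R :=
  let Pd := move3 g Pi in     (* Pi_{rho mu nu} *)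
  let Pm := move13 g Pi in    (* Pi_rho^mu_nu *)
  let p := trace23 g Pi in
  let pt := trace13 g Pi in
  let pd := move1 g p in
  let ptd := move1 g pt in
  fun mu nu =>
    4^-1 * (\sum_al \sum_be Pi al mu be * Pm be nu al)
    + 2^-1 * symmetrize
        (fun m n => \sum_al \sum_be Pi m al be * Pm al n be) mu nu
    + 24^-1 * (p mu * p nu)
    - 12^-1 * (pt mu * pt nu)
    - 6^-1 * symmetrize (fun m n => p m * pt n) mu nu
    + 12^-1 * (\sum_al pd al * Pi al mu nu)
    - 6^-1 * (\sum_al ptd al * Pi al mu nu)
    - 6^-1 * (\sum_al pd al * symmetrize (fun m n => Pi m n al) mu nu)
    - 6^-1 * (\sum_al ptd al * symmetrize (fun m n => Pi m n al) mu nu)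
    + invmx g mu nu *
      (- (8^-1 * \sum_rho \sum_al \sum_be Pi rho al be * Pd al be rho)
       - 48^-1 * dot p pd
       + 24^-1 * dot pt ptd
       + 12^-1 * dot p ptd).

(* Main.v *)
Require Import Defs.
From mathcomp Require Import all_boot all_order all_fingroup all_algebra.
From mathcomp Require Import all_classical all_reals all_analysis.
From mathcomp Require Import ring.

Import Order.TTheory GRing.Theory Num.Theory.
Import numFieldNormedType.Exports.

Local Open Scope classical_set_scope.
Local Open Scope ring_scope.

(* The Levi-Civita connection of g is Gamma + N, where N is algebraic in g and   *)
(* Q = nabla g.  Since nabla is flat and torsionless, covariant derivatives      *)
(* commute, so nabla_a Q_{bmn} is symmetric in a and b, and both sides of the    *)
(* first identity are polynomials in the inverse metric, Q and nabla Q.          *)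
(* Fix a point x and P0 with P0^T g P0 = diag(-1, 1, 1, 1).  Along the mu-th     *)
(* coordinate line use the frame P(t) = (1 - t Gamma_mu) P0, which is parallel   *)
(* to first order: ordinary derivatives at t = 0 of the components in this frame *)
(* are covariant derivatives, and equivariance under GL(4) replaces all of the   *)
(* covariant Leibniz rules.  What remains is a polynomial identity in Q and      *)
(* nabla Q over the Minkowski metric, checked component by component.            *)
(* The potential V is -vol / (2 kappa^2) times the metric derivative of the      *)
(* Hamiltonian, which turns the first identity into the second.                  *)

Set Implicit Arguments.
Unset Strict Implicit.
Unset Printing Implicit Defensive.

(** * Derivatives of matrix fields *)

(** Write N for [diff_tensor], the difference between the Levi-Civita connection and [Gam]. As [Gam]
    has no curvature, the Levi-Civita curvature is the antisymmetrized covariant derivative of N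
    plus terms quadratic in N ([curvature_christoffel]). Write P for [superpotential], so that the
    momentum is -2 / kappa^2 times vol P. Since nabla_r vol = vol Q_r / 2, division by vol turns the
    first identity into G = nabla_r P^r + Q_r P^r / 2 + 4 V[P], which is [einstein_superpotential];
    the 4 is the square of the factor -2.

    All ingredients are natural under changes of frame ([superpotential_act3], [diff_tensor_act3],
    [stegr_potential_act3]), so the identity may be checked in one frame where the metric is
    Minkowski: [frame_identity_sym]. It needs nabla_a Q_{bmn} symmetric in a and b. That is
    [covQ_comm], the Ricci identity applied to g, which rests on the symmetry of second partial
    derivatives ([partial_comm]).

    For the Hamiltonian, let S be the quadratic form [momentum_square]. Its variation along h is 4
    V^{mn} h_{mn} + tr(h g^-1) S / 2 ([momentum_square_derives]); the variation of 1 / vol cancels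
    the last term, leaving -2 kappa^2 V / vol as the metric derivative ([hamiltonian_derives]).
    Inserting this into the first identity gives the second, and invertibility of g gives the
    equivalence of the field equations. *)

Section Calculus.
Context {R : realType} {V : normedModType R}.
Implicit Types (f g : V -> R) (x v : V).

(** Reduces directional derivatives to derivatives at 0 of functions of one real variable, the form
    used for all tensor computations below. *)
Lemma is_derive_lineP f x v df :
  is_derive x v f df <-> is_derive (0 : R) 1 (fun t => f (t *: v + x)) df.
Proof.
have E : 'D_v f x = 'D_1 (fun t : R => f (t *: v + x)) 0.
  rewrite /derive; set g1 := fun h => h^-1 *: _; set g2 := fun h => h^-1 *: _.
  suff -> : g1 = g2 by [].
  by apply/funext => h; rewrite /g1 /g2 /= addr0 scale0r add0r [_%:A]mulr1.
split=> -[dv <-].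
  by split; [exact: (derivable1P f x v).1 | rewrite E].
by split; [exact: (derivable1P f x v).2 | rewrite E].
Qed.

Lemma is_derive_add f g x v df dg : is_derive x v f df -> is_derive x v g dg ->
  is_derive x v (fun y => f y + g y) (df + dg).
Proof. exact: is_deriveD. Qed.

Lemma is_derive_sub f g x v df dg : is_derive x v f df -> is_derive x v g dg ->
  is_derive x v (fun y => f y - g y) (df - dg).
Proof. exact: is_deriveB. Qed.

Lemma is_derive_opp f x v df : is_derive x v f df ->
  is_derive x v (fun y => - f y) (- df).
Proof. exact: is_deriveN. Qed.

Lemma is_derive_mul f g x v df dg : is_derive x v f df -> is_derive x v g dg ->
  is_derive x v (fun y => f y * g y) (df * g x + f x * dg).
Proof.
move=> hf hg; apply: (is_derive_eq (is_deriveM hf hg)).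
by rewrite addrC /GRing.scale/= [g x * _]mulrC.
Qed.

Lemma is_derive_scale (k : R) f x v df : is_derive x v f df ->
  is_derive x v (fun y => k * f y) (k * df).
Proof. exact: is_deriveZ. Qed.

Lemma is_derive_invf f x v df : f x != 0 -> is_derive x v f df ->
  is_derive x v (fun y => (f y)^-1) (- (f x ^- 2 * df)).
Proof.
move=> fx [dv <-]; split; first exact: derivableV.
by rewrite deriveV // scaleNr.
Qed.

Lemma is_derive_bigsum (I : Type) (r : seq I) (h : I -> V -> R) (dh : I -> R) x v :
  (forall i, is_derive x v (h i) (dh i)) ->
  is_derive x v (fun y => \sum_(i <- r) h i y) (\sum_(i <- r) dh i).
Proof.
move=> H; elim: r => [|i r IH].
  rewrite big_nil (_ : (fun y => _) = cst 0); first exact: is_derive_cst.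
  by apply/funext => y; rewrite big_nil.
rewrite big_cons (_ : (fun y => _) = fun y => h i y + \sum_(j <- r) h j y).
  exact: is_derive_add.
by apply/funext => y; rewrite big_cons.
Qed.

Lemma is_derive_bigprod n (h : 'I_n -> V -> R) (dh : 'I_n -> R) x v :
  (forall i, is_derive x v (h i) (dh i)) ->
  is_derive x v (fun y => \prod_i h i y)
    (\sum_i \prod_j (if j == i then dh j else h j x)).
Proof.
elim: n h dh => [|n IH] h dh H.
  rewrite big_ord0 (_ : (fun y => _) = cst 1); first exact: is_derive_cst.
  by apply/funext => y; rewrite big_ord0.
rewrite (_ : (fun y => _) = fun y => h ord0 y * \prod_i h (lift ord0 i) y); last first.
  by apply/funext => y; rewrite big_ord_recl.
apply: is_derive_eq.
  apply: (is_derive_mul (H ord0)).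
  by apply: (IH (fun i => h (lift ord0 i)) (fun i => dh (lift ord0 i))) => i; exact: H.
rewrite [RHS]big_ord_recl; congr (_ + _).
  by rewrite big_ord_recl eqxx; congr (_ * _); apply: eq_bigr.
rewrite mulr_sumr; apply: eq_bigr => i _.
by rewrite big_ord_recl /=; congr (_ * _); apply: eq_bigr.
Qed.

(** Jacobi's formula: the determinant is linear in each row, and the row that is differentiated is
    expanded in cofactors. *)
Lemma is_derive_det n (A : V -> 'M[R]_n) (dA : 'M[R]_n) x v :
  (forall i j, is_derive x v (fun y => A y i j) (dA i j)) ->
  is_derive x v (fun y => \det (A y))
    (\sum_i \sum_j dA i j * cofactor (A x) i j).
Proof.
move=> H.
have Hs (s : {perm 'I_n}) : is_derive x v (fun y => (-1) ^+ s * \prod_i A y i (s i))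
    ((-1) ^+ s * \sum_i \prod_j (if j == i then dA j (s j) else A x j (s j))).
  apply: is_derive_scale.
  by apply: (is_derive_bigprod (h := fun i y => A y i (s i)) (dh := fun i => dA i (s i))).
apply: (is_derive_eq (is_derive_bigsum _ Hs)).
under eq_bigr do rewrite mulr_sumr.
rewrite exchange_big /=; apply: eq_bigr => i _.
(* [B] is [A x] with row [i] differentiated. Expansion along row [i] deletes that row, so the
   cofactors are those of [A x]. *)
pose B := \matrix_(k, j) if k == i then dA k j else A x k j.
transitivity (\det B).
  apply: eq_bigr => s _; congr (_ * _); apply: eq_bigr => j _.
  by rewrite mxE.
rewrite (expand_det_row _ i); apply: eq_bigr => j _.
rewrite mxE eqxx /cofactor; congr (_ * (_ * \det _)).
apply/matrixP => k l; rewrite !mxE eq_sym.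
by rewrite (negbTE (neq_lift _ _)).
Qed.

Lemma derivable_bigdet n (A : V -> 'M[R]_n) x v :
  (forall i j, derivable (fun y => A y i j) x v) -> derivable (fun y => \det (A y)) x v.
Proof.
move=> H; have [] // := @is_derive_det n A (\matrix_(i,
  j) 'D_v (fun y => A y i j) x) x v _.
by move=> i j; rewrite mxE; exact: derivableP.
Qed.

End Calculus.

(** * Inverse of a curve of matrices *)

Section InverseMatrix.
Context {R : realType}.

Lemma near_unitmx n (A : R -> 'M[R]_n) :
  (forall i j, derivable (fun t => A t i j) 0 1) -> A 0 \in unitmx ->
  \forall t \near 0, A t \in unitmx.
Proof.
move=> H A0.
have c : {for 0, continuous (fun t => \det (A t))}.
  by apply/differentiable_continuous/derivable1_diffP/derivable_bigdet.
have : \forall t \near (0 : R), \det (A t) != 0.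
  by apply: (cvgr_neq0 _ c); rewrite -unitfE -unitmxE.
by apply: filterS => t; rewrite unitmxE unitfE.
Qed.

Lemma is_derive_invmx_line n (A : R -> 'M[R]_n) (dA : 'M[R]_n) :
  (forall i j, is_derive (0 : R) 1 (fun t => A t i j) (dA i j)) ->
  A 0 \in unitmx ->
  forall i j, is_derive (0 : R) 1 (fun t => invmx (A t) i j)
    ((- (invmx (A 0) *m dA *m invmx (A 0))) i j).
Proof.
move=> H A0.
have HA i j : derivable (fun t => A t i j) 0 1 by have [] := H i j.
have U := near_unitmx HA A0.
have dB i j : derivable (fun t => invmx (A t) i j) 0 1.
  (* Cramer's formula gives derivability. It holds only near 0, because [invmx] returns its argument
     on singular matrices. *)
  have E : \forall t \near (0 : R), (\det (A t))^-1 * \adj (A t) i j = invmx (A t) i j.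
    by move: U; apply: filterS => t At; rewrite /invmx At [RHS]mxE.
  apply: (near_eq_derivable E).
  apply: derivableM; last first.
    rewrite /adjugate (_ : (fun t => _) = fun t => cofactor (A t) j i).
      apply: derivableZ; apply: derivable_bigdet => k l.
      rewrite (_ : (fun t => _) = fun t => A t (lift j k) (lift i l)) //.
      by apply/funext => t; rewrite !mxE.
    by apply/funext => t; rewrite mxE.
  apply: derivableV; first by rewrite -unitfE -unitmxE.
  exact: derivable_bigdet.
pose dBm := \matrix_(i, j) 'D_1 (fun t => invmx (A t) i j) 0.
suff -> : - (invmx (A 0) *m dA *m invmx (A 0)) = dBm.
  by move=> i j; rewrite mxE; exact: derivableP.
(* Once derivability is known, the product rule applied to A A^-1 = 1 determines the derivative. *)
have E : dA *m invmx (A 0) + A 0 *m dBm = 0.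
  apply/matrixP => i j.
  have h1 : is_derive (0 : R) 1 (fun t => \sum_k A t i k * invmx (A t) k j)
      (\sum_k (dA i k * invmx (A 0) k j + A 0 i k * dBm k j)).
    apply: is_derive_bigsum => k; apply: (is_derive_mul (H i k)).
    by rewrite mxE; exact: derivableP.
  have h2 : is_derive (0 : R) 1 (fun t => \sum_k A t i k * invmx (A t) k j) 0.
    apply: (near_eq_is_derive (f := cst ((1%:M : 'M[R]_n) i j))).
      move: U; apply: filterS => t At.
      by rewrite -(mulmxV At) mxE.
  rewrite !mxE -big_split /=.
  exact: etrans (esym (@derive_val _ _ _ _ _ _ _ h1)) (@derive_val _ _ _ _ _ _ _ h2).
by rewrite -mulmxA -mulmxN -[- _]add0r -E addrAC subrr add0r mulKmx.
Qed.

End InverseMatrix.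

(** * The volume density *)

Section VolumeDerivative.
Context {R : realType}.

Lemma is_derive_vol (A : R -> 'M[R]_4) (dA : 'M[R]_4) :
  (forall i j, is_derive (0 : R) 1 (fun t => A t i j) (dA i j)) ->
  \det (A 0) < 0 ->
  is_derive (0 : R) 1 (fun t => vol (A t))
    (vol (A 0) * (2^-1 * \tr (dA *m invmx (A 0)))).
Proof.
move=> hA d0; have dN : 0 < - \det (A 0) by rewrite oppr_gt0.
have hd := is_derive_opp (is_derive_det hA).
rewrite (_ : (fun t => vol (A t)) = Num.sqrt \o (fun t => - \det (A t))) //.
have hs := is_derive1_sqrt dN.
apply: (is_derive_eq (@is_derive1_comp _ Num.sqrt (fun t => - \det (A t)) 0 _ _ hs hd)).
have u : A 0 \in unitmx by rewrite unitmxE unitfE lt_eqF.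
have -> : \sum_i \sum_j dA i j * cofactor (A 0) i j =
    \det (A 0) * \tr (dA *m invmx (A 0)).
  rewrite mulr_sumr; apply: eq_bigr => i _; rewrite mxE mulr_sumr.
  apply: eq_bigr => j _; rewrite /invmx u !mxE [RHS]mulrCA; congr (dA i j * _).
  by rewrite mulrA divff ?mul1r // -unitfE -unitmxE.
have v0 : vol (A 0) != 0 by rewrite gt_eqF // sqrtr_gt0.
have vv : vol (A 0) * vol (A 0) = - \det (A 0) by rewrite -expr2 sqr_sqrtr // ltW.
rewrite -/(vol (A 0)) -mulNr -vv; field.
by rewrite v0.
Qed.

End VolumeDerivative.

(** * Mixed partial derivatives *)

Section MixedPartials.
Context {R : realType} {V : normedModType R}.
Implicit Types (f : V -> R) (x y u v : V).

Lemma is_derive_affine f u y (s df : R) :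
  is_derive (s *: u + y) u f df -> is_derive s 1 (fun s => f (s *: u + y)) df.
Proof.
move=> /(is_derive_lineP f (s *: u + y) u df).1 h.
apply: (@is_derive_lineP R R (fun s => f (s *: u + y)) s 1 df).2.
rewrite (_ : (fun t => _) = fun t => f (t *: u + (s *: u + y))) //.
by apply/funext => t; rewrite scalerDl addrA [t%:A]mulr1.
Qed.

Lemma box_nbhs x u v (N : set V) : nbhs x N -> exists2 h : R, 0 < h &
  forall s t, 0 <= s <= h -> 0 <= t <= h -> N (s *: u + (t *: v + x)).
Proof.
move=> /nbhs_ballP[r /= r0 rN]; pose k := `|u| + `|v| + 1.
have k0 : 0 < k by rewrite ltr_wpDl // addr_ge0.
exists (r / k) => [|s t /andP[s0 sh] /andP[t0 th]]; first exact: divr_gt0.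
apply: rN; rewrite -ball_normE /ball_ /= addrA opprD addrCA subrr addr0 normrN.
apply: (le_lt_trans (ler_normD _ _)); rewrite !normrZ !ger0_norm //.
apply: (@le_lt_trans _ _ (r / k * (`|u| + `|v|))).
  by rewrite mulrDr lerD // ler_wpM2r.
rewrite -[ltRHS](divfK (lt0r_neq0 k0)) ltr_pM2l ?divr_gt0 //.
by rewrite ltrDl.
Qed.

Lemma MVT_closed (F dF : R -> R) (h : R) : 0 < h ->
  (forall s, 0 <= s <= h -> is_derive s 1 F (dF s)) ->
  exists2 s, 0 <= s <= h & F h - F 0 = dF s * h.
Proof.
move=> h0 H.
have [s|c|s sh E] := @MVT_segment _ F dF 0 h (ltW h0).
- by rewrite in_itv /= => /andP[s0 sh]; apply: H; rewrite !ltW.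
- apply: derivable_within_continuous => s; rewrite in_itv /= => sh.
  by have [] := H _ sh.
by exists s; [move: sh; rewrite in_itv | rewrite E subr0].
Qed.

(** The mean value theorem twice: for the increment of [f] in direction [v] as a function of the
    [u]-parameter, then for ['D_u f] along [v]. *)
Lemma second_difference f u v x (h : R) : 0 < h ->
  (forall s t, 0 <= s <= h -> 0 <= t <= h ->
     derivable f (s *: u + (t *: v + x)) u /\
     derivable ('D_u f) (s *: u + (t *: v + x)) v) ->
  exists s t, [/\ 0 <= s <= h, 0 <= t <= h &
    f (h *: u + (h *: v + x)) - f (h *: u + x) - f (h *: v + x) + f x
    = 'D_v ('D_u f) (s *: u + (t *: v + x)) * h * h].
Proof.
move=> h0 H; have hh : 0 <= h <= h by rewrite lexx ltW.
have h00 : 0 <= (0 : R) <= h by rewrite lexx ltW.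
have H1 s : 0 <= s <= h -> is_derive s 1
    (fun s => f (s *: u + (h *: v + x)) - f (s *: u + (0 *: v + x)))
    ('D_u f (s *: u + (h *: v + x)) - 'D_u f (s *: u + (0 *: v + x))).
  move=> sh; apply: is_derive_sub; apply: is_derive_affine; apply: derivableP.
    exact: (H s h sh hh).1.
  exact: (H s 0 sh h00).1.
have [s sh E1] := MVT_closed h0 H1.
have H2 t : 0 <= t <= h -> is_derive t 1
    (fun t => 'D_u f (t *: v + (s *: u + x))) ('D_v ('D_u f) (t *: v + (s *: u + x))).
  move=> th; apply: (@is_derive_affine ('D_u f) v (s *: u + x)); apply: derivableP.
  by rewrite addrCA; exact: (H s t sh th).2.
have [t th E2] := MVT_closed h0 H2.
exists s, t; split=> //; move: E1; rewrite !scale0r !add0r => E1.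
rewrite [s *: u + _]addrCA -E2 [h *: v + (s *: u + x)]addrCA scale0r add0r -E1.
by ring.
Qed.

Lemma near_half_dist_neq (a b p q : R) :
  `|a - p| < `|a - b| / 2 -> `|b - q| < `|a - b| / 2 -> p <> q.
Proof.
move=> ap bq pq; rewrite -{}pq distrC in bq.
have lt_ab := ltrD ap bq; rewrite -splitr in lt_ab.
by have := le_lt_trans (ler_distD p a b) lt_ab; rewrite ltxx.
Qed.

(** If [A x] and [B x] differed, the values of [A] and [B] at any two points near [x] would differ
    too. But in a small box the same second difference, divided by [h * h], is a value of [A] and a
    value of [B]. *)
Lemma second_difference_limit f (A B : V -> R) u v x (U : set V) : nbhs x U ->
  {for x, continuous A} -> {for x, continuous B} ->
  (forall h, 0 < h ->
    (forall s t, 0 <= s <= h -> 0 <= t <= h -> U (s *: u + (t *: v + x))) ->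
    exists s t, [/\ 0 <= s <= h, 0 <= t <= h &
    f (h *: u + (h *: v + x)) - f (h *: u + x) - f (h *: v + x) + f x
    = A (s *: u + (t *: v + x)) * h * h]) ->
  (forall h, 0 < h ->
    (forall s t, 0 <= s <= h -> 0 <= t <= h -> U (s *: v + (t *: u + x))) ->
    exists s t, [/\ 0 <= s <= h, 0 <= t <= h &
    f (h *: v + (h *: u + x)) - f (h *: v + x) - f (h *: u + x) + f x
    = B (s *: v + (t *: u + x)) * h * h]) ->
  A x = B x.
Proof.
move=> xU cA cB dA dB.
have step h : f (h *: u + (h *: v + x)) - f (h *: u + x) - f (h *: v + x) + f x =
    f (h *: v + (h *: u + x)) - f (h *: v + x) - f (h *: u + x) + f x.
  by rewrite [h *: v + (h *: u + x)]addrCA; congr (_ + _); exact: addrAC.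
apply/eqP; rewrite -subr_eq0 -normr_le0 leNgt; apply/negP => d0.
have e0 : 0 < `|A x - B x| / 2 by rewrite divr_gt0.
have nA : \forall y \near x, `|A x - A y| < `|A x - B x| / 2.
  exact: (@cvgr_dist_lt _ _ _ _ _ _ _ cA).
have nB : \forall y \near x, `|B x - B y| < `|A x - B x| / 2.
  exact: (@cvgr_dist_lt _ _ _ _ _ _ _ cB).
have [h h0 H] := box_nbhs u v (filterI xU (filterI nA nB)).
have [s [t [sh th E1]]] := dA h h0 (fun s t sh th => (H s t sh th).1).
have H' s' t' : 0 <= s' <= h -> 0 <= t' <= h -> U (s' *: v + (t' *: u + x)).
  by move=> sh' th'; rewrite addrCA; exact: (H t' s' th' sh').1.
have [s' [t' [sh' th' E2]]] := dB h h0 H'.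
have AB : A (s *: u + (t *: v + x)) = B (s' *: v + (t' *: u + x)).
  apply: (mulIf (lt0r_neq0 h0)); apply: (mulIf (lt0r_neq0 h0)).
  exact: etrans (esym E1) (etrans (step h) E2).
rewrite [s' *: v + _]addrCA in AB.
exact: (near_half_dist_neq (H s t sh th).2.1 (H t' s' th' sh').2.2 AB).
Qed.

(** Schwarz's theorem, for mixed derivatives that are continuous at the point. *)
Lemma mixed_derive_comm f u v x (U : set V) : nbhs x U ->
  (forall y, U y -> derivable f y u) -> (forall y, U y -> derivable f y v) ->
  (forall y, U y -> derivable ('D_u f) y v) -> (forall y, U y ->
    derivable ('D_v f) y u) ->
  {for x, continuous ('D_v ('D_u f))} -> {for x, continuous ('D_u ('D_v f))} ->
  'D_v ('D_u f) x = 'D_u ('D_v f) x.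
Proof.
move=> xU fu fv fuv fvu cA cB; apply: (second_difference_limit xU cA cB) => h h0 H.
  apply: second_difference h0 _ => s t sh th; have Ust := H s t sh th.
  by split; [exact: fu | exact: fuv].
apply: second_difference h0 _ => s t sh th; have Ust := H s t sh th.
by split; [exact: fv | exact: fvu].
Qed.

End MixedPartials.

Lemma partial_comm (R : realType) (U : set 'rV[R]_4) (f : 'rV[R]_4 -> R) x c d :
  open U -> U x -> smooth_on U f ->
  partial c (partial d f) x = partial d (partial c f) x.
Proof.
move=> Uo Ux sm; apply: (@mixed_derive_comm R _ f _ _ x U) => //.
- exact: open_nbhs_nbhs.
- by move=> y Uy; exact: diff_derivable (sm [::] y Uy).
- by move=> y Uy; exact: diff_derivable (sm [::] y Uy).
- by move=> y Uy; exact: diff_derivable (sm [:: d] y Uy).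
- by move=> y Uy; exact: diff_derivable (sm [:: c] y Uy).
- by apply: differentiable_continuous; exact: (sm [:: c; d] x Ux).
- by apply: differentiable_continuous; exact: (sm [:: d; c] x Ux).
Qed.

(** * Explicit enumeration of the four indices *)

Definition o0 : 'I_4 := @Ordinal 4 0 isT.
Definition o1 : 'I_4 := @Ordinal 4 1 isT.
Definition o2 : 'I_4 := @Ordinal 4 2 isT.
Definition o3 : 'I_4 := @Ordinal 4 3 isT.

Lemma sum_ord4 (R : nmodType) (f : 'I_4 -> R) :
  \sum_i f i = f o0 + (f o1 + (f o2 + f o3)).
Proof.
rewrite !big_ord_recl big_ord0 addr0.
by congr (f _ + (f _ + (f _ + f _))); apply: val_inj.
Qed.

Lemma forall_ord4 (P : 'I_4 -> Prop) : P o0 -> P o1 -> P o2 -> P o3 -> forall i, P i.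
Proof.
move=> h0 h1 h2 h3 [[|[|[|[|//]]]] hi].
- by rewrite (_ : Ordinal hi = o0)//; apply: val_inj.
- by rewrite (_ : Ordinal hi = o1)//; apply: val_inj.
- by rewrite (_ : Ordinal hi = o2)//; apply: val_inj.
- by rewrite (_ : Ordinal hi = o3)//; apply: val_inj.
Qed.

(** * The identity over the Minkowski metric *)

Section FrameAlgebra.
Context {R : realType}.
Implicit Types (Q P n : tensor3 R) (S : 'I_4 -> tensor3 R)
  (W : tensor2 R).

(* Comparisons of indices by [Nat.eqb] and [Nat.leb] reduce on concrete indices. *)
Definition mink (i : 'I_4) : R := if Nat.eqb i 0%N then -1 else 1.
Local Notation e := mink.

Definition frame_metric (a b : 'I_4) : R := if Nat.eqb a b then e a else 0.
Definition ftrace23 Q r := \sum_l e l * Q r l l.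
Definition ftrace13 Q r := \sum_l e l * Q l r l.

(* First variations, when the Minkowski metric varies by [W], of the raised      *)
(* array, of its raised traces, of the inverse metric and of the superpotential. *)
Definition d_raise W Q dQ a b c :=
  e a * e b * e c * (dQ a b c
   - \sum_d e d * (W a d * Q d b c + W b d * Q a d c + W c d * Q a b d)).
Definition d_trace23 W Q dQ r : R :=
  e r * (ftrace23 dQ r - (\sum_l \sum_k e l * e k * W l k * Q r l k)
          - \sum_d e d * W r d * ftrace23 Q d).
Definition d_trace13 W Q dQ r : R :=
  e r * (ftrace13 dQ r - (\sum_l \sum_k e l * e k * W l k * Q l r k)
          - \sum_d e d * W r d * ftrace13 Q d).
Definition d_inverse W a b : R := - (e a * e b * W a b).

Definition d_superpotential W Q dQ r m v :=
  - (2^-1 * d_raise W Q dQ r m v) + 2^-1 * d_raise W Q dQ m v r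
    + 2^-1 * d_raise W Q dQ v m r
  + 2^-1 * (d_trace23 W Q dQ r - d_trace13 W Q dQ r) * frame_metric m v
  + 2^-1 * (e r * ftrace23 Q r - e r * ftrace13 Q r) * d_inverse W m v
  - 4^-1 * (d_inverse W r m * (e v * ftrace23 Q v) + frame_metric r m * d_trace23 W Q dQ v
          + (d_inverse W r v * (e m * ftrace23 Q m)
            + frame_metric r v * d_trace23 W Q dQ m)).

(* Raising the first index gives the difference between the Levi-Civita          *)
(* connection and Gamma.                                                         *)
Definition disformation Q l m v : R := 2^-1 * (Q m l v + Q v l m - Q l m v).
(** The term in [W] comes from the variation of the inverse metric that raises the first index. *)
Definition d_disformation W Q dQ r m v :=
  e r * (disformation dQ r m v - \sum_a e a * W r a * disformation Q a m v).

(* Inverse of [disformation]: Q_{rmv} = n_{mvr} + n_{vmr}. *)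
Definition nonmetricity_of n r m v : R := n m v r + n v m r.

(** The raised traces of [P] are passed as arguments, so that their short expressions can be used
    instead of the sums that define them. *)
Definition frame_potential P (p pt : 'I_4 -> R) m v :=
  4^-1 * (\sum_a \sum_b P a m b * (e b * e a * P b v a))
  + 2^-1 * (2^-1 * (\sum_a \sum_b P m a b * (e a * e b * P a v b)
    + \sum_a \sum_b P v a b * (e a * e b * P a m b)))
  + 24^-1 * (p m * p v) - 12^-1 * (pt m * pt v)
  - 6^-1 * (2^-1 * (p m * pt v + p v * pt m))
  + 12^-1 * (\sum_a e a * p a * P a m v)
  - 6^-1 * (\sum_a e a * pt a * P a m v)
  - 6^-1 * (\sum_a e a * p a * (2^-1 * (P m v a + P v m a)))
  - 6^-1 * (\sum_a e a * pt a * (2^-1 * (P m v a + P v m a)))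
  + frame_metric m v * (- (8^-1 *
      \sum_r \sum_a \sum_b P r a b * (e a * e b * e r * P a b r))
    - 48^-1 * (\sum_a p a * (e a * p a)) + 24^-1 * (\sum_a pt a * (e a * pt a))
    + 12^-1 * (\sum_a p a * (e a * pt a))).

(* P_{rmv} = n_{rmv} + (a - b)_r g_{mv} / 2 - (g_{rm} a_v + g_{rv} a_m) / 2 with   *)
(* a_i = n^l_{li} and b_i = n_i^l_l.                                              *)
Definition frame_superpotential n (a b : 'I_4 -> R) r m v : R :=
  e r * e m * e v * n r m v
  + 2^-1 * (e r * (a r - b r) * frame_metric m v)
  - 2^-1 * (frame_metric r m * (e v * a v) + frame_metric r v * (e m * a m)).

(** The contraction of nabla N - nabla N + N N - N N. No term in Gamma occurs, since covariant
    derivatives are ordinary ones in the parallel frame and the background is flat; [S r] stands for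
    nabla_r Q. *)
Definition frame_ricci_of n S s v : R :=
  (\sum_r e r * (disformation (S r) r s v
      - \sum_a e a * nonmetricity_of n r r a * n a s v))
  - (\sum_r e r * (disformation (S v) r s r
      - \sum_a e a * nonmetricity_of n v r a * n a s r))
  + (\sum_r \sum_l e r * n r l r * (e l * n l s v))
  - (\sum_r \sum_l e r * n r l v * (e l * n l s r)).

(** The first identity divided by vol. The term in [a r] is the logarithmic derivative Q_r / 2 of
    the volume, and the last two arguments of [frame_potential] are the traces of the
    superpotential. *)
Definition frame_identity_for n a b S m v :=
  e m * e v * frame_ricci_of n S m v
  - 2^-1 * frame_metric m v * \sum_a e a * frame_ricci_of n S a a =
  \sum_r d_superpotential (nonmetricity_of n r) (nonmetricity_of n) (S r) r m v
  + (\sum_r a r * frame_superpotential n a b r m v)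
  + 4 * frame_potential (frame_superpotential n a b)
    (fun r => e r * (a r - b r)) (fun r => e r * (- a r - 2^-1 * b r)) m v.

Definition sym23 n (i j k : 'I_4) := if Nat.leb j k then n i j k else n i k j.
(** The two symmetries exchange disjoint pairs of slots, so ordering each pair separately selects
    one representative of every orbit. *)
Definition sym_second S (l i j k : 'I_4) :=
  if Nat.leb l i then sym23 (S l) i j k else sym23 (S i) l j k.

(* [n] and the second derivatives are replaced by arbitrary arrays symmetrized    *)
(* by a computable choice of representatives, so that equal entries become        *)
(* syntactically equal once the indices are concrete; then the identity is        *)
(* polynomial in independent variables.                                           *)
Lemma frame_identity_sym S n0 (m v : 'I_4) : let n := sym23 n0 in
  frame_identity_for n (fun i => \sum_l e l * n l l i)
    (fun i => \sum_l e l * n i l l) (sym_second S) m v.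
Proof.
(* The traces stay folded while the outer sums are expanded. *)
move=> n; set a := fun i => _; set b := fun i => _.
rewrite /frame_identity_for /frame_potential !sum_ord4 /frame_ricci_of
  !sum_ord4 /d_superpotential /d_raise /d_trace23 /d_trace13 !sum_ord4.
rewrite /ftrace23 /ftrace13 !sum_ord4 /frame_superpotential /a /b !sum_ord4.
(* On concrete indices [cbv] decides every comparison; sixteen polynomial identities remain. *)
move: m v; apply: forall_ord4; apply: forall_ord4;
  cbv [mink sym_second n sym23 frame_metric Nat.leb Nat.eqb nat_of_ord o0 o1 o2 o3
    d_inverse nonmetricity_of disformation];
  by field.
Qed.

End FrameAlgebra.

(** * Equivariance under GL(4) *)

Section TensorAction.
Context {R : realType}.
Implicit Types (A B C P m : 'M[R]_4) (Y Z : tensor3 R) (T : tensor2 R)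
  (v w : tensor1 R).

Definition act3 A B C Y : tensor3 R := fun a b c =>
  \sum_d \sum_e \sum_f A a d * B b e * C c f * Y d e f.

(** Slices with one index frozen are matrices: actions on the other slots become matrix products,
    and contractions become traces. *)
Definition slot1 Y (a : 'I_4) : 'M[R]_4 := \matrix_(b, c) Y a b c.
Definition slot2 Y (b : 'I_4) : 'M[R]_4 := \matrix_(a, c) Y a b c.

Lemma slot1_act3 A B C Y a :
  slot1 (act3 A B C Y) a = \sum_d A a d *: (B *m slot1 Y d *m C^T).
Proof.
apply/matrixP => b c; rewrite mxE summxE; apply: eq_bigr => d _.
rewrite !mxE mulr_sumr exchange_big /=; apply: eq_bigr => f _.
rewrite !mxE mulr_suml mulr_sumr; apply: eq_bigr => e _.
by rewrite !mxE; ring.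
Qed.

Lemma slot2_act3 A B C Y b :
  slot2 (act3 A B C Y) b = \sum_e B b e *: (A *m slot2 Y e *m C^T).
Proof.
apply/matrixP => a c; rewrite mxE summxE /act3 exchange_big /=.
apply: eq_bigr => e _.
rewrite !mxE mulr_sumr exchange_big /=; apply: eq_bigr => f _.
rewrite !mxE mulr_suml mulr_sumr; apply: eq_bigr => d _.
by rewrite !mxE; ring.
Qed.

Lemma slot1P Y Z : slot1 Y = slot1 Z -> Y = Z.
Proof.
move=> H; apply/funext => a; apply/funext => b; apply/funext => c.
by have /matrixP/(_ b c) := congr1 (@^~ a) H; rewrite !mxE.
Qed.

Lemma act3_comp A B C A' B' C' Y :
  act3 A B C (act3 A' B' C' Y) = act3 (A *m A') (B *m B') (C *m C') Y.
Proof.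
apply: slot1P; apply/funext => a; rewrite !slot1_act3.
under eq_bigr do rewrite slot1_act3 mulmx_sumr mulmx_suml scaler_sumr.
rewrite exchange_big /=; apply: eq_bigr => d _.
rewrite mxE scaler_suml; apply: eq_bigr => e _.
by rewrite -scalemxAr -scalemxAl scalerA trmx_mul !mulmxA.
Qed.

Lemma act3_1 Y : act3 1%:M 1%:M 1%:M Y = Y.
Proof.
apply: slot1P; apply/funext => a; rewrite slot1_act3 (bigD1 a) //= big1 => [|i ia].
  by rewrite mxE eqxx scale1r mul1mx trmx1 mulmx1 addr0.
by rewrite mxE eq_sym (negbTE ia) scale0r.
Qed.

Lemma move3E m Y : move3 m Y = act3 m m m Y. Proof. by []. Qed.

Lemma act3_swap23 A B C Y a b c :
  act3 A B C Y a b c = act3 A C B (fun a b c => Y a c b) a c b.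
Proof.
rewrite /act3; apply: eq_bigr => d _; rewrite exchange_big /=.
by do 2![apply: eq_bigr => ? _]; ring.
Qed.

Lemma act3_swap12 A B C Y a b c :
  act3 A B C Y a b c = act3 B A C (fun a b c => Y b a c) b a c.
Proof.
rewrite /act3 exchange_big /=.
by do 3![apply: eq_bigr => ? _]; ring.
Qed.

Lemma act3_rot A Y a b c :
  act3 A A A Y b c a = act3 A A A (fun a b c => Y b c a) a b c.
Proof. by rewrite act3_swap23 act3_swap12. Qed.

Lemma act3D A B C Y Z a b c :
  act3 A B C Y a b c + act3 A B C Z a b c =
  act3 A B C (fun a b c => Y a b c + Z a b c) a b c.
Proof.
rewrite /act3 -big_split; apply: eq_bigr => d _ /=.
rewrite -big_split; apply: eq_bigr => e _ /=.
rewrite -big_split; apply: eq_bigr => f _ /=.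
by rewrite mulrDr.
Qed.

Lemma act3Z A B C k Y a b c :
  k * act3 A B C Y a b c = act3 A B C (fun a b c => k * Y a b c) a b c.
Proof.
rewrite /act3 mulr_sumr; apply: eq_bigr => d _.
rewrite mulr_sumr; apply: eq_bigr => e _.
rewrite mulr_sumr; apply: eq_bigr => f _.
by rewrite mulrCA.
Qed.

Lemma act3N A B C Y a b c :
  - act3 A B C Y a b c = act3 A B C (fun a b c => - Y a b c) a b c.
Proof.
rewrite -mulN1r act3Z; congr (act3 _ _ _ _ _ _ _).
by do 3![apply/funext => ?]; rewrite mulN1r.
Qed.

Lemma act3_sum (I : Type) (r : seq I) A B C (Y : I -> tensor3 R) a b c :
  \sum_(i <- r) act3 A B C (Y i) a b c =
  act3 A B C (fun a b c => \sum_(i <- r) Y i a b c) a b c.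
Proof.
elim: r => [|i r IH].
  rewrite big_nil /act3 big1 // => d _; rewrite big1 // => e _; rewrite big1 // => f _.
  by rewrite big_nil mulr0.
rewrite big_cons IH act3D; congr (act3 _ _ _ _ _ _ _).
by do 3![apply/funext => ?]; rewrite big_cons.
Qed.

Lemma act3_tensor P v (M : 'M[R]_4) a b c :
  move1 P v a * (P *m M *m P^T) b c = act3 P P P (fun a b c => v a * M b c) a b c.
Proof.
rewrite /move1 mulr_suml; apply: eq_bigr => d _.
rewrite mxE mulr_sumr exchange_big /=; apply: eq_bigr => f _.
rewrite !mxE mulr_suml mulr_sumr; apply: eq_bigr => e _.
by ring.
Qed.

Lemma move1_comp A B v : move1 A (move1 B v) = move1 (A *m B) v.
Proof.
apply/funext => a; rewrite /move1.
under eq_bigr do rewrite mulr_sumr.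
rewrite exchange_big; apply: eq_bigr => b _ /=.
by rewrite mxE mulr_suml; apply: eq_bigr => c _; rewrite mulrA.
Qed.

Lemma move1_1 v : move1 1%:M v = v.
Proof.
apply/funext => a; rewrite /move1 (bigD1 a) //= big1 => [|i ia].
  by rewrite mxE eqxx mul1r addr0.
by rewrite mxE eq_sym (negbTE ia) mul0r.
Qed.

Lemma trace23E m Y r : trace23 m Y r = \tr (m^T *m slot1 Y r).
Proof.
rewrite /trace23 exchange_big; apply: eq_bigr => k _ /=.
by rewrite mxE; apply: eq_bigr => l _; rewrite !mxE.
Qed.

Lemma trace13E m Y r : trace13 m Y r = \tr (m^T *m slot2 Y r).
Proof.
rewrite /trace13 exchange_big; apply: eq_bigr => k _ /=.
by rewrite mxE; apply: eq_bigr => l _; rewrite !mxE.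
Qed.

(** Cyclicity of the trace moves the matrices acting on the contracted slots onto [m]. *)
Lemma trace23_act3 m A B C Y :
  trace23 m (act3 A B C Y) = move1 A (trace23 (B^T *m m *m C) Y).
Proof.
apply/funext => r; rewrite trace23E slot1_act3 mulmx_sumr raddf_sum.
apply: eq_bigr => d _ /=; rewrite trace23E -scalemxAr mxtraceZ; congr (_ * _).
by rewrite !mulmxA mxtrace_mulC !trmx_mul trmxK !mulmxA.
Qed.

Lemma trace13_act3 m A B C Y :
  trace13 m (act3 A B C Y) = move1 B (trace13 (A^T *m m *m C) Y).
Proof.
apply/funext => r; rewrite trace13E slot2_act3 mulmx_sumr raddf_sum.
apply: eq_bigr => d _ /=; rewrite trace13E -scalemxAr mxtraceZ; congr (_ * _).
by rewrite !mulmxA mxtrace_mulC !trmx_mul trmxK !mulmxA.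
Qed.

Lemma contract1_act3 A B C (M : 'M[R]_4) Y a b c :
  \sum_d M a d * act3 A B C Y d b c = act3 (M *m A) B C Y a b c.
Proof.
transitivity (slot1 (act3 M 1%:M 1%:M (act3 A B C Y)) a b c).
  rewrite slot1_act3 summxE; apply: eq_bigr => d _.
  by rewrite trmx1 mulmx1 mul1mx !mxE.
by rewrite act3_comp !mul1mx mxE.
Qed.

Lemma invmx_congr (g P : 'M[R]_4) : g \in unitmx -> P \in unitmx ->
  invmx (P^T *m g *m P) = invmx P *m invmx g *m invmx P^T.
Proof.
move=> gu Pu; have Ptu : P^T \in unitmx by rewrite unitmx_tr.
set A := P^T *m g *m P; have Au : A \in unitmx by rewrite !unitmx_mul Ptu gu Pu.
rewrite -[RHS](mulKmx Au) -[LHS]mulmx1; congr (_ *m _).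
rewrite !mulmxA /A -(mulmxA _ P) mulmxV // mulmx1 -(mulmxA _ g) mulmxV //.
by rewrite mulmx1 mulmxV.
Qed.

(** Naturality: the columns of [P] are a frame, in which the components of the metric and of [Q] are
    [P^T *m g *m P] and [move3 P^T Q]. *)
Lemma superpotential_act3 (g P : 'M[R]_4) Q : g \in unitmx -> P \in unitmx ->
  superpotential g Q =
  move3 P (superpotential (P^T *m g *m P) (move3 P^T Q)).
Proof.
move=> gu Pu; set g' := P^T *m g *m P; set Q' := move3 P^T Q.
have Ptu : P^T \in unitmx by rewrite unitmx_tr.
have gi' : invmx g' = invmx P *m invmx g *m invmx P^T by exact: invmx_congr.
have gi : invmx g = P *m invmx g' *m P^T.
  by rewrite gi' !mulmxA mulmxV // mul1mx mulmxKV.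
have QE : Q = act3 (invmx P^T) (invmx P^T) (invmx P^T) Q'.
  by rewrite /Q' move3E act3_comp mulVmx // act3_1.
have giP : invmx g *m invmx P^T = P *m invmx g'.
  by rewrite gi mulmxK.
have tE : (invmx P^T)^T *m invmx g *m invmx P^T = invmx g'.
  by rewrite trmx_inv trmxK gi'.
have qE : move1 (invmx g) (trace23 (invmx g) Q) =
    move1 P (move1 (invmx g') (trace23 (invmx g') Q')).
  by rewrite {1}QE trace23_act3 tE !move1_comp giP.
have qtE : move1 (invmx g) (trace13 (invmx g) Q) =
    move1 P (move1 (invmx g') (trace13 (invmx g') Q')).
  by rewrite {1}QE trace13_act3 tE !move1_comp giP.
have QuE : move3 (invmx g) Q = move3 P (move3 (invmx g') Q').
  by rewrite {1}QE !move3E !act3_comp giP.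
apply/funext => r; apply/funext => m; apply/funext => v.
rewrite /superpotential qE qtE QuE gi.
set q := move1 (invmx g') _; set qt := move1 (invmx g') _.
set Qu := move3 (invmx g') Q'; rewrite !move3E.
(* Every term is brought to the slot order r, m, v, so that all of them merge under a single
   [act3]. *)
rewrite [act3 _ _ _ Qu m v r]act3_rot.
rewrite [act3 _ _ _ Qu v m r](act3_swap12 P) [act3 _ _ _ _ m v r]act3_rot /=.
rewrite mulrBr mulrBl -!mulrA ![_ * move1 P _ _]mulrC !act3_tensor.
rewrite [act3 _ _ _ _ v r m]act3_rot [act3 _ _ _ _ m r v]act3_swap12.
rewrite [act3 _ _ _ _ m v r]act3_rot.
rewrite !(act3Z, act3N, act3D).
congr (act3 _ _ _ _ _ _ _); do 3![apply/funext => ?].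
by ring.
Qed.

Lemma superpotential_sym (g : 'M[R]_4) Q (r k l : 'I_4) : g^T = g ->
  (forall a b c, Q a b c = Q a c b) ->
  superpotential g Q r k l = superpotential g Q r l k.
Proof.
move=> gT Qs; rewrite /superpotential.
have giT a b : invmx g a b = invmx g b a by rewrite -[in LHS]gT -trmx_inv mxE.
have QE : (fun a b c => Q a c b) = Q by do 3![apply/funext => ?].
have uS a b c : move3 (invmx g) Q a b c = move3 (invmx g) Q a c b.
  by rewrite move3E act3_swap23 QE.
rewrite (uS r k l) (giT k l) (uS l k r) (uS k l r).
by ring.
Qed.

Lemma move2E m T a b :
  move2 m T a b = (m *m (\matrix_(c, d) T c d) *m m^T) a b.
Proof.
rewrite mxE /move2 exchange_big /=; apply: eq_bigr => d _.
rewrite !mxE mulr_suml; apply: eq_bigr => c _.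
by rewrite !mxE; ring.
Qed.

Lemma move2_mx m (M : 'M[R]_4) a b : (m *m M *m m^T) a b = move2 m M a b.
Proof.
by rewrite move2E; congr ((_ *m _ *m _) _ _); apply/matrixP => i j; rewrite mxE.
Qed.

Lemma move2_comp A B T : move2 A (move2 B T) = move2 (A *m B) T.
Proof.
apply/funext => a; apply/funext => b; rewrite !move2E trmx_mul !mulmxA.
congr ((_ *m _) a b); rewrite -!mulmxA; congr (_ *m _).
by apply/matrixP => c d; rewrite mxE move2E mulmxA.
Qed.

Lemma move2D m T U a b :
  move2 m T a b + move2 m U a b = move2 m (fun a b => T a b + U a b) a b.
Proof.
rewrite /move2 -big_split; apply: eq_bigr => c _ /=.
by rewrite -big_split; apply: eq_bigr => d _ /=; rewrite mulrDr.
Qed.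

Lemma move2Z m k T a b : k * move2 m T a b = move2 m (fun a b => k * T a b) a b.
Proof.
rewrite /move2 mulr_sumr; apply: eq_bigr => c _.
by rewrite mulr_sumr; apply: eq_bigr => d _; rewrite mulrCA.
Qed.

Lemma move2_sum (I : Type) (r : seq I) m (T : I -> tensor2 R) a b :
  \sum_(i <- r) move2 m (T i) a b = move2 m (fun a b => \sum_(i <- r) T i a b) a b.
Proof.
elim: r => [|i r IH].
  rewrite big_nil /move2 big1 // => c _; rewrite big1 // => d _.
  by rewrite big_nil mulr0.
rewrite big_cons IH move2D; congr (move2 _ _ _ _).
by do 2![apply/funext => ?]; rewrite big_cons.
Qed.

Lemma move2N m T a b : - move2 m T a b = move2 m (fun a b => - T a b) a b.
Proof.
rewrite -mulN1r move2Z; congr (move2 _ _ _ _).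
by do 2![apply/funext => ?]; rewrite mulN1r.
Qed.

Lemma move2_tr m T a b : move2 m T b a = move2 m (fun a b => T b a) a b.
Proof.
rewrite /move2 exchange_big; apply: eq_bigr => c _ /=.
by apply: eq_bigr => d _; rewrite [m b d * _]mulrC.
Qed.

Lemma move2_tensor m v w a b :
  move1 m v a * move1 m w b = move2 m (fun a b => v a * w b) a b.
Proof.
rewrite /move1 mulr_suml; apply: eq_bigr => c _.
by rewrite mulr_sumr; apply: eq_bigr => d _; rewrite mulrACA.
Qed.

Lemma dot_move1 A v w : dot (move1 A v) w = dot v (move1 A^T w).
Proof.
rewrite /dot /move1; under eq_bigr do rewrite mulr_suml.
rewrite exchange_big; apply: eq_bigr => d _ /=.
by rewrite mulr_sumr; apply: eq_bigr => a _; rewrite mxE; ring.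
Qed.

Lemma contract_act3 A P v Y b c :
  \sum_d v d * act3 A P P Y d b c =
  move2 P (fun b c => \sum_d move1 A^T v d * Y d b c) b c.
Proof.
have -> : \sum_d v d * act3 A P P Y d b c =
    (\sum_d v d *: slot1 (act3 A P P Y) d) b c.
  by rewrite summxE; apply: eq_bigr => d _; rewrite !mxE.
rewrite move2E; congr (fun_of_matrix _ _ _).
have -> : \matrix_(c, d) (\sum_a move1 A^T v a * Y a c d) =
    \sum_a move1 A^T v a *: slot1 Y a.
  by apply/matrixP => i j; rewrite mxE summxE; apply: eq_bigr => a _; rewrite !mxE.
rewrite mulmx_sumr mulmx_suml.
under eq_bigr do rewrite slot1_act3 scaler_sumr.
rewrite exchange_big; apply: eq_bigr => d _ /=.
rewrite -scalemxAr -scalemxAl /move1 scaler_suml; apply: eq_bigr => a _.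
by rewrite scalerA mxE mulrC.
Qed.

(** Adjointness for the full contraction, reduced by slicing to cyclicity of the trace. *)
Lemma act3_dual A B C Y Z :
  \sum_a \sum_b \sum_c act3 A B C Y a b c * Z a b c =
  \sum_a \sum_b \sum_c Y a b c * act3 A^T B^T C^T Z a b c.
Proof.
have E (X W : tensor3 R) : \sum_a \sum_b \sum_c X a b c * W a b c =
    \sum_a \tr (slot1 X a *m (slot1 W a)^T).
  apply: eq_bigr => a _; apply: eq_bigr => b _; rewrite mxE.
  by apply: eq_bigr => c _; rewrite !mxE.
rewrite !E; under eq_bigr do rewrite slot1_act3 mulmx_suml raddf_sum.
rewrite exchange_big; apply: eq_bigr => d _ /=.
rewrite slot1_act3 [(\sum_i _)^T]raddf_sum mulmx_sumr raddf_sum; apply: eq_bigr => a _ /=.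
rewrite linearZ -scalemxAl -scalemxAr !mxtraceZ mxE; congr (_ * _).
by rewrite /= !trmx_mul !trmxK -!mulmxA mxtrace_mulC !mulmxA.
Qed.

Lemma act3_1l B Y a b c : act3 1%:M B B Y a b c = move2 B (Y a) b c.
Proof.
rewrite /act3 (bigD1 a) //= [X in _ + X]big1 => [|d da].
  rewrite addr0; apply: eq_bigr => e _; apply: eq_bigr => f _.
  by rewrite mxE eqxx mul1r.
rewrite big1 // => e _; rewrite big1 // => f _.
by rewrite mxE eq_sym (negbTE da) !mul0r.
Qed.

Lemma contract_slot22 Y Z (m n : 'I_4) :
  \sum_a \sum_b Y a m b * Z b n a = \tr (slot2 Y m *m slot2 Z n).
Proof.
apply: eq_bigr => a _; rewrite mxE.
by apply: eq_bigr => b _; rewrite !mxE.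
Qed.

Lemma contract_slot12 Y Z (m n : 'I_4) :
  \sum_a \sum_b Y m a b * Z a n b = \tr ((slot1 Y m)^T *m slot2 Z n).
Proof.
rewrite exchange_big; apply: eq_bigr => b _; rewrite mxE.
by apply: eq_bigr => a _; rewrite !mxE.
Qed.

Lemma slot2_move13 m Y b : slot2 (move13 m Y) b = m *m slot2 Y b *m m^T.
Proof.
apply/matrixP => a c; rewrite [RHS]move2_mx mxE /move13 /move2.
by do 2![apply: eq_bigr => ? _]; rewrite mxE.
Qed.

(** Under the trace the frames on the contracted slots meet [g] and turn it into the frame metric;
    only those on the free indices survive. *)
Lemma trace_congr P (g : 'M[R]_4) (X W : 'I_4 -> 'M[R]_4) (m n : 'I_4) :
  \tr ((\sum_d P m d *: (P *m X d *m P^T)) *m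
       (g *m (\sum_e P n e *: (P *m W e *m P^T)) *m g^T)) =
  move2 P (fun k l => \tr (X k *m ((P^T *m g *m P) *m W l *m (P^T *m g *m P)^T))) m n.
Proof.
rewrite mulmx_suml raddf_sum; apply: eq_bigr => d _ /=.
rewrite mulmx_sumr mulmx_suml mulmx_sumr raddf_sum; apply: eq_bigr => e _ /=.
rewrite -scalemxAl -scalemxAr -scalemxAl -scalemxAr !mxtraceZ mulrA; congr (_ * _).
rewrite -!mulmxA mxtrace_mulC !trmx_mul trmxK !mulmxA.
by [].
Qed.

(** The potential is quadratic in the momentum; this extracts the factor by which the momentum
    differs from the superpotential. *)
Lemma stegr_potential_scale (c : R) Y (g : 'M[R]_4) (m n : 'I_4) :
  stegr_potential (fun r a b => c * Y r a b) g m n = c ^+ 2 * stegr_potential Y g m n.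
Proof.
have h23 : trace23 g (fun r a b => c * Y r a b) = fun r => c * trace23 g Y r.
  apply/funext => r; rewrite /trace23 mulr_sumr; apply: eq_bigr => l _.
  by rewrite mulr_sumr; apply: eq_bigr => k _; rewrite mulrCA.
have h13 : trace13 g (fun r a b => c * Y r a b) = fun r => c * trace13 g Y r.
  apply/funext => r; rewrite /trace13 mulr_sumr; apply: eq_bigr => l _.
  by rewrite mulr_sumr; apply: eq_bigr => k _; rewrite mulrCA.
have mv1 v : move1 g (fun r => c * v r) = fun r => c * move1 g v r.
  by apply/funext => r; rewrite /move1 mulr_sumr; apply: eq_bigr => k _; rewrite mulrCA.
have mv3 : move3 g (fun r a b => c * Y r a b) = fun r a b => c * move3 g Y r a b.
  by do 3![apply/funext => ?]; rewrite !move3E -act3Z.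
have mv13 : move13 g (fun r a b => c * Y r a b) = fun r a b => c * move13 g Y r a b.
  do 3![apply/funext => ?]; rewrite /move13 mulr_sumr; apply: eq_bigr => l _.
  by rewrite mulr_sumr; apply: eq_bigr => k _; rewrite mulrCA.
have S1 (F H : 'I_4 -> R) : \sum_a c * F a * (c * H a) = c ^+ 2 * \sum_a F a * H a.
  by rewrite mulr_sumr; apply: eq_bigr => a _; ring.
have S2 (F H : 'I_4 -> 'I_4 -> R) : \sum_a \sum_b c * F a b * (c * H a b) =
    c ^+ 2 * \sum_a \sum_b F a b * H a b.
  by rewrite mulr_sumr; apply: eq_bigr => a _; rewrite S1.
have S3 (F H : 'I_4 -> 'I_4 -> 'I_4 -> R) :
    \sum_r \sum_a \sum_b c * F r a b * (c * H r a b) =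
    c ^+ 2 * \sum_r \sum_a \sum_b F r a b * H r a b.
  by rewrite mulr_sumr; apply: eq_bigr => a _; rewrite S2.
have S4 (u : tensor1 R) : \sum_a c * u a * symmetrize
  (fun k l : 'I_4 => c * Y k l a) m n =
    c ^+ 2 * \sum_a u a * symmetrize (fun k l : 'I_4 => Y k l a) m n.
  by rewrite mulr_sumr; apply: eq_bigr => a _; rewrite /symmetrize; ring.
rewrite /stegr_potential h23 h13 !mv1 mv3 mv13 !S4 !(S2 _ (fun a b => move13 g Y b _ a)).
rewrite !(S3 _ (fun r a b => move3 g Y a b r)) !(S1 _
  (fun a => Y a _ _)) /dot !S1 /symmetrize.
rewrite !(S2 _ (fun a b => move13 g Y a _ b)).
by ring.
Qed.

Lemma tr_slot1_act3 P Y a :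
  (slot1 (act3 P P P Y) a)^T = \sum_d P a d *: (P *m (slot1 Y d)^T *m P^T).
Proof.
rewrite slot1_act3 raddf_sum; apply: eq_bigr => d _ /=.
by rewrite linearZ /= !trmx_mul trmxK mulmxA.
Qed.

Lemma stegr_potential_act3 (g P : 'M[R]_4) Y (m n : 'I_4) :
  g \in unitmx -> P \in unitmx ->
  stegr_potential (act3 P P P Y) g m n =
  move2 P (stegr_potential Y (P^T *m g *m P)) m n.
Proof.
move=> gu Pu; set g' := P^T *m g *m P.
have gi : invmx g = P *m invmx g' *m P^T.
  rewrite invmx_congr // !mulmxA mulmxV // mul1mx mulmxKV //.
  by rewrite unitmx_tr.
have dE v w : dot (move1 P v) (move1 g (move1 P w)) = dot v (move1 g' w).
  by rewrite dot_move1 !move1_comp.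
have cE v a b : \sum_al move1 g (move1 P v) al * act3 P P P Y al a b =
    move2 P (fun a b => \sum_al move1 g' v al * Y al a b) a b.
  by rewrite contract_act3 !move1_comp.
have c3E v a b : \sum_al move1 g (move1 P v) al * act3 P P P Y a b al =
    move2 P (fun a b => \sum_al move1 g' v al * Y a b al) a b.
  under eq_bigr do rewrite act3_rot.
  by rewrite contract_act3 !move1_comp.
have sE v a b : \sum_al move1 g (move1 P v) al *
      (2^-1 * (act3 P P P Y a b al + act3 P P P Y b a al)) =
    move2 P (fun a b => \sum_al move1 g' v al * (2^-1 * (Y a b al + Y b a al))) a b.
  under eq_bigr do rewrite mulrCA mulrDr.
  rewrite -mulr_sumr big_split /= !c3E [move2 _ _ b a]move2_tr move2D move2Z.
  congr (move2 _ _ _ _); apply/funext => ?; apply/funext => ?.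
  by rewrite -big_split mulr_sumr; apply: eq_bigr => al _ /=; ring.
have HE : \sum_r \sum_a \sum_b act3 P P P Y r a b * move3 g (act3 P P P Y) a b r =
    \sum_r \sum_a \sum_b Y r a b * move3 g' Y a b r.
  rewrite !move3E act3_comp.
  under eq_bigr => r _ do under eq_bigr => a _ do under eq_bigr => b _ do
    rewrite [act3 (g *m P) _ _ _ _ _ _]act3_rot.
  (* Transferring [P] from the first factor to the second completes [g *m P] to the frame metric. *)
  rewrite (act3_dual _ _ _ _ (act3 _ _ _ _)); do 3![apply: eq_bigr => ? _].
  by rewrite act3_comp mulmxA -act3_rot.
rewrite /stegr_potential /symmetrize !trace23_act3 !trace13_act3 !dE !cE !sE HE.
rewrite !contract_slot22 !contract_slot12 !slot2_move13 !tr_slot1_act3 !slot2_act3.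
rewrite !trace_congr gi !move2_tensor move2_mx [_ * (_ - _ + _ + _)]mulrC.
rewrite ![move2 _ _ n m]move2_tr.
rewrite !(move2Z, move2N, move2D).
congr (move2 _ _ _ _); apply/funext => a; apply/funext => b.
rewrite !contract_slot22 !contract_slot12 !slot2_move13.
by ring.
Qed.

End TensorAction.

(** * Derivatives along a frame *)

Section FrameDerivatives.
Context {R : realType}.
Implicit Types (A B C : R -> 'M[R]_4) (Y : R -> tensor3 R).

Notation derives f df := (is_derive (0 : R) (1 : R) (f : R -> R) df).

Definition mx_derives A (dA : 'M[R]_4) := forall i j, derives (fun t => A t i j) (dA i j).
Definition tensor_derives Y (dY : tensor3 R) :=
  forall a b c, derives (fun t => Y t a b c) (dY a b c).

Lemma mx_derives_cst (A : 'M[R]_4) : mx_derives (fun=> A) 0.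
Proof. by move=> i j; rewrite mxE; exact: is_derive_cst. Qed.

Lemma mx_derives_tr A dA : mx_derives A dA -> mx_derives (fun t => (A t)^T) dA^T.
Proof.
move=> h i j; rewrite mxE (_ : (fun t => _) = fun t => A t j i); first exact: h.
by apply/funext => t; rewrite mxE.
Qed.

Lemma mx_derives_mul A B dA dB : mx_derives A dA -> mx_derives B dB ->
  mx_derives (fun t => A t *m B t) (dA *m B 0 + A 0 *m dB).
Proof.
move=> hA hB i j.
rewrite (_ : (fun t => _) = fun t => \sum_k A t i k * B t k j); last first.
  by apply/funext => t; rewrite mxE.
rewrite !mxE -big_split /=; apply: is_derive_bigsum => k.
exact: (is_derive_mul (hA i k) (hB k j)).
Qed.

Lemma mx_derives_inv A dA : mx_derives A dA -> A 0 \in unitmx ->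
  mx_derives (fun t => invmx (A t)) (- (invmx (A 0) *m dA *m invmx (A 0))).
Proof. by move=> hA A0 i j; exact: (is_derive_invmx_line hA A0). Qed.

Lemma act3_derives A B C Y dA dB dC dY :
  mx_derives A dA -> mx_derives B dB -> mx_derives C dC -> tensor_derives Y dY ->
  tensor_derives (fun t => act3 (A t) (B t) (C t) (Y t))
    (fun a b c => act3 dA (B 0) (C 0) (Y 0) a b c + act3 (A 0) dB (C 0) (Y 0) a b c
      + act3 (A 0) (B 0) dC (Y 0) a b c + act3 (A 0) (B 0) (C 0) dY a b c).
Proof.
move=> hA hB hC hY a b c.
apply: is_derive_eq.
  apply: is_derive_bigsum => d; apply: is_derive_bigsum => e.
  apply: is_derive_bigsum => f.
  exact: (is_derive_mul (is_derive_mul (is_derive_mul (hA a d) (hB b e)) (hC c f))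
    (hY d e f)).
rewrite /act3 -!big_split; apply: eq_bigr => d _ /=.
rewrite -!big_split; apply: eq_bigr => e _ /=.
rewrite -!big_split; apply: eq_bigr => f _ /=.
by ring.
Qed.

Lemma move1_trace23_derives A Y dA dY r : mx_derives A dA -> tensor_derives Y dY ->
  derives (fun t => move1 (A t) (trace23 (A t) (Y t)) r)
   (move1 dA (trace23 (A 0) (Y 0)) r +
    move1 (A 0) (fun r => trace23 dA (Y 0) r + trace23 (A 0) dY r) r).
Proof.
move=> hA hY; rewrite /move1 -big_split /=; apply: is_derive_bigsum => b.
apply: (is_derive_mul (hA r b)); rewrite /trace23 -big_split /=.
apply: is_derive_bigsum => l; rewrite -big_split /=.
apply: is_derive_bigsum => k; exact: (is_derive_mul (hA l k) (hY b l k)).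
Qed.

Lemma move1_trace13_derives A Y dA dY r : mx_derives A dA -> tensor_derives Y dY ->
  derives (fun t => move1 (A t) (trace13 (A t) (Y t)) r)
   (move1 dA (trace13 (A 0) (Y 0)) r +
    move1 (A 0) (fun r => trace13 dA (Y 0) r + trace13 (A 0) dY r) r).
Proof.
move=> hA hY; rewrite /move1 -big_split /=; apply: is_derive_bigsum => b.
apply: (is_derive_mul (hA r b)); rewrite /trace13 -big_split /=.
apply: is_derive_bigsum => l; rewrite -big_split /=.
apply: is_derive_bigsum => k; exact: (is_derive_mul (hA l k) (hY l b k)).
Qed.

(** * The Minkowski matrix and variations around it *)

Definition minkowski : 'M[R]_4 := diag_mx (\row_(i < 4) (if i == 0 then -1 else 1)).

Lemma eqb_ord n (a b : 'I_n) : Nat.eqb a b = (a == b).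
Proof.
apply/idP/eqP => [/PeanoNat.Nat.eqb_eq/val_inj //|->].
exact: PeanoNat.Nat.eqb_refl.
Qed.

Lemma minkE a : mink a = if a == 0 then -1 else 1 :> R.
Proof. by rewrite /mink -eqb_ord. Qed.

Lemma minkowskiE a b : minkowski a b = frame_metric a b.
Proof.
by rewrite !mxE /frame_metric eqb_ord minkE; case: (a == b).
Qed.

Lemma sum_minkowski a (f : 'I_4 -> R) : \sum_b minkowski a b * f b = mink a * f a.
Proof.
rewrite (bigD1 a) //= big1 => [|i ia].
  by rewrite minkowskiE /frame_metric PeanoNat.Nat.eqb_refl addr0.
by rewrite mxE eq_sym (negbTE ia) mulr0n mul0r.
Qed.

Lemma move1_minkowski v a : move1 minkowski v a = mink a * v a.
Proof. exact: sum_minkowski. Qed.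

Lemma trace23_minkowski (Z : tensor3 R) a : trace23 minkowski Z a = ftrace23 Z a.
Proof.
rewrite /trace23 /ftrace23; apply: eq_bigr => l _.
exact: (sum_minkowski l (fun k => Z a l k)).
Qed.

Lemma trace13_minkowski (Z : tensor3 R) a : trace13 minkowski Z a = ftrace13 Z a.
Proof.
rewrite /trace13 /ftrace13; apply: eq_bigr => l _.
exact: (sum_minkowski l (fun k => Z l a k)).
Qed.

Lemma act3_minkowski23 (A : 'M[R]_4) (Z : tensor3 R) a b c :
  act3 A minkowski minkowski Z a b c = mink b * mink c * \sum_d A a d * Z d b c.
Proof.
transitivity (\sum_d A a d * (mink b * (mink c * Z d b c))).
  apply: eq_bigr => d _; rewrite -(sum_minkowski b (fun e => mink c * Z d e c)) mulr_sumr.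
  apply: eq_bigr => e _; rewrite -(sum_minkowski c (fun f => Z d e f)) !mulr_sumr;
    apply: eq_bigr => f _; ring.
rewrite mulr_sumr; apply: eq_bigr => d _; ring.
Qed.

Lemma act3_minkowski (Z : tensor3 R) a b c :
  act3 minkowski minkowski minkowski Z a b c = mink a * mink b * mink c * Z a b c.
Proof. by rewrite act3_minkowski23 (sum_minkowski a (fun d => Z d b c)); ring. Qed.

Lemma minkowski_tr : minkowski^T = minkowski.
Proof. exact: tr_diag_mx. Qed.

Lemma mink_sq a : mink a * mink a = 1 :> R.
Proof. by rewrite minkE; case: (a == 0); rewrite ?mulrNN mulr1. Qed.

Lemma minkowski_sq : minkowski *m minkowski = 1%:M.
Proof.
apply/matrixP => a b; rewrite mxE sum_minkowski minkowskiE mxE /frame_metric eqb_ord.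
by case: (a == b); rewrite ?mink_sq ?mulr0.
Qed.

Lemma minkowski_unit : minkowski \in unitmx.
Proof. by have [] := mulmx1_unit minkowski_sq. Qed.

Lemma invmx_minkowski : invmx minkowski = minkowski.
Proof. by rewrite -[RHS](mulKmx minkowski_unit) minkowski_sq mulmx1. Qed.

Lemma minkowski_congr (W : 'M[R]_4) a b :
  (- (minkowski *m W *m minkowski)) a b = d_inverse W a b.
Proof.
rewrite /d_inverse mxE -mulmxA mxE sum_minkowski mxE; congr (- _); rewrite -mulrA;
  congr (_ * _).
rewrite -(sum_minkowski b (W a)); apply: eq_bigr => c _.
by rewrite -[in LHS]minkowski_tr mxE mulrC.
Qed.

(** [I'] is the derivative of the inverse metric when the metric is Minkowski and varies by [W]. *)
Lemma d_raise_minkowski (W : 'M[R]_4) (Q dQ : tensor3 R) a b c : let I' := -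
  (minkowski *m W *m minkowski) in
  act3 I' minkowski minkowski Q a b c + act3 minkowski I' minkowski Q a b c +
  act3 minkowski minkowski I' Q a b c + act3 minkowski minkowski minkowski dQ a b c
  = d_raise W Q dQ a b c.
Proof.
move=> I'; rewrite [act3 minkowski I' _ _ _ _ _]act3_swap12.
rewrite [act3 minkowski _ I' _ _ _ _]act3_swap23 [act3 minkowski I' _ _ _ _ _]act3_swap12.
have E x (f : 'I_4 -> R) : \sum_d I' x d * f d =
  - (mink x * \sum_d mink d * (W x d * f d)).
  rewrite mulr_sumr -sumrN; apply: eq_bigr => d _.
  by rewrite minkowski_congr /d_inverse; ring.
rewrite act3_minkowski !act3_minkowski23 /d_raise !E.
under [in RHS]eq_bigr do rewrite !mulrDr.
by rewrite !big_split /=; ring.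
Qed.

Lemma d_trace23_minkowski (W : 'M[R]_4) (Q dQ : tensor3 R) r : let I' := -
  (minkowski *m W *m minkowski) in
  move1 I' (trace23 minkowski Q) r +
  move1 minkowski (fun r => trace23 I' Q r + trace23 minkowski dQ r) r =
    d_trace23 W Q dQ r.
Proof.
move=> I'; have IE a b : I' a b = d_inverse W a b by exact: minkowski_congr.
rewrite move1_minkowski trace23_minkowski /d_trace23.
have -> : move1 I' (trace23 minkowski Q) r =
  - (mink r * \sum_d mink d * W r d * ftrace23 Q d).
  rewrite mulr_sumr -sumrN; apply: eq_bigr => d _.
  by rewrite IE trace23_minkowski /d_inverse; ring.
have -> : trace23 I' Q r = - \sum_l \sum_k mink l * mink k * W l k * Q r l k.
  rewrite -sumrN; apply: eq_bigr => l _; rewrite -sumrN; apply: eq_bigr => k _.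
  by rewrite IE /d_inverse; ring.
by ring.
Qed.

Lemma d_trace13_minkowski (W : 'M[R]_4) (Q dQ : tensor3 R) r : let I' := -
  (minkowski *m W *m minkowski) in
  move1 I' (trace13 minkowski Q) r +
  move1 minkowski (fun r => trace13 I' Q r + trace13 minkowski dQ r) r =
    d_trace13 W Q dQ r.
Proof.
move=> I'; have IE a b : I' a b = d_inverse W a b by exact: minkowski_congr.
rewrite move1_minkowski trace13_minkowski /d_trace13.
have -> : move1 I' (trace13 minkowski Q) r =
  - (mink r * \sum_d mink d * W r d * ftrace13 Q d).
  rewrite mulr_sumr -sumrN; apply: eq_bigr => d _.
  by rewrite IE trace13_minkowski /d_inverse; ring.
have -> : trace13 I' Q r = - \sum_l \sum_k mink l * mink k * W l k * Q l r k.
  rewrite -sumrN; apply: eq_bigr => l _; rewrite -sumrN; apply: eq_bigr => k _.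
  by rewrite IE /d_inverse; ring.
by ring.
Qed.

Lemma superpotential_derives (G : R -> 'M[R]_4) Y (W : 'M[R]_4) dY :
  G 0 = minkowski -> mx_derives
    (fun t => invmx (G t)) (- (minkowski *m W *m minkowski)) ->
  tensor_derives Y dY ->
  tensor_derives (fun t => superpotential (G t) (Y t))
    (fun r m v => d_superpotential W (Y 0) dY r m v).
Proof.
move=> G0 hG hY r m v.
have I0 : invmx (G 0) = minkowski by rewrite G0 invmx_minkowski.
have hU a b c : derives (fun t => move3 (invmx (G t)) (Y t) a b c)
    (d_raise W (Y 0) dY a b c).
  by rewrite -d_raise_minkowski; have := act3_derives hG hG hG hY a b c; rewrite I0.
have hq a : derives (fun t => move1 (invmx (G t)) (trace23 (invmx (G t)) (Y t)) a)
    (d_trace23 W (Y 0) dY a).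
  by rewrite -d_trace23_minkowski; have := move1_trace23_derives a hG hY; rewrite I0.
have hqt a : derives (fun t => move1 (invmx (G t)) (trace13 (invmx (G t)) (Y t)) a)
    (d_trace13 W (Y 0) dY a).
  by rewrite -d_trace13_minkowski; have := move1_trace13_derives a hG hY; rewrite I0.
have h1 := is_derive_opp (is_derive_scale 2^-1 (hU r m v)).
have h2 := is_derive_scale 2^-1 (hU m v r).
have h3 := is_derive_scale 2^-1 (hU v m r).
have h4 := is_derive_mul (is_derive_scale 2^-1 (is_derive_sub (hq r) (hqt r))) (hG m v).
have h5 := is_derive_scale 4^-1 (is_derive_add (is_derive_mul (hG r m) (hq v))
  (is_derive_mul (hG r v) (hq m))).
apply: (is_derive_eq (is_derive_sub (is_derive_add (is_derive_add
  (is_derive_add h1 h2) h3) h4) h5)).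
rewrite /= !I0 !minkowski_congr !minkowskiE !move1_minkowski !trace23_minkowski
  !trace13_minkowski /d_superpotential.
ring.
Qed.

(** N^a_{bc}: the first index is up, the other two are down. *)
Definition diff_tensor (gi : 'M[R]_4) (Q : tensor3 R) : tensor3 R :=
  act3 gi 1%:M 1%:M (disformation Q).

Lemma diff_tensor_derives (I : R -> 'M[R]_4) Y (W : 'M[R]_4) dY :
  I 0 = minkowski -> mx_derives I (- (minkowski *m W *m minkowski)) ->
    tensor_derives Y dY ->
  tensor_derives (fun t => diff_tensor (I t) (Y t))
    (fun r m v => d_disformation W (Y 0) dY r m v).
Proof.
move=> I0 hI hY r m v.
have hn : tensor_derives (fun t => disformation (Y t)) (disformation dY).
  move=> a b c; exact: (is_derive_scale 2^-1 (is_derive_sub (is_derive_add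
    (hY b a c) (hY c a b)) (hY a b c))).
apply: (is_derive_eq (act3_derives hI (mx_derives_cst 1%:M)
  (mx_derives_cst 1%:M) hn r m v)).
have z2 (A B : 'M[R]_4) Z : act3 A 0 B Z r m v = 0.
  by rewrite /act3 big1 // => d _; rewrite big1 // => e _; rewrite big1 // => f _;
    rewrite mxE mulr0 !mul0r.
have z3 (A B : 'M[R]_4) Z : act3 A B 0 Z r m v = 0.
  by rewrite /act3 big1 // => d _; rewrite big1 // => e _; rewrite big1 // => f _;
    rewrite mxE mulr0 !mul0r.
have E (M : 'M[R]_4) Z : act3 M 1%:M 1%:M Z r m v = \sum_d M r d * Z d m v.
  by rewrite -[M]mulmx1 -contract1_act3 mulmx1; apply: eq_bigr => d _; rewrite act3_1.
rewrite z2 z3 !addr0 !E I0 (sum_minkowski r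
  (fun d => disformation dY d m v)) /d_disformation.
rewrite mulrBr addrC mulr_sumr -sumrN; congr (_ + _); apply: eq_bigr => d _.
by rewrite minkowski_congr /d_inverse; ring.
Qed.

(** The variation is jointly linear in [W] and [dQ], so a derivative along a coordinate direction
    splits into derivatives along the frame directions. *)
Lemma d_superpotential_sum (W : 'I_4 -> 'I_4 -> 'I_4 ->
  R) (Q : tensor3 R) S (c : 'I_4 -> R) r m v :
  d_superpotential (fun a b => \sum_i c i * W i a b) Q
    (fun a b d => \sum_i c i * S i a b d) r m v
  = \sum_i c i * d_superpotential (W i) Q (S i) r m v.
Proof.
rewrite /d_superpotential /d_raise /d_trace23 /d_trace13 /d_inverse /ftrace23
  /ftrace13 !sum_ord4; ring.
Qed.

Lemma d_disformation_sum (W : 'I_4 -> 'I_4 -> 'I_4 ->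
  R) (Q : tensor3 R) S (c : 'I_4 -> R) r m v :
  d_disformation (fun a b => \sum_i c i * W i a b) Q
    (fun a b d => \sum_i c i * S i a b d) r m v
  = \sum_i c i * d_disformation (W i) Q (S i) r m v.
Proof.
rewrite /d_disformation /disformation !sum_ord4; ring.
Qed.

End FrameDerivatives.

(** * The Minkowski identity in terms of Q *)

Section FrameIdentity.
Context {R : realType}.
Implicit Types (Q Y : tensor3 R) (S : 'I_4 -> tensor3 R).

Definition frame_ricci Q S s v : R :=
  (\sum_r d_disformation (Q r) Q (S r) r s v) - (\sum_r d_disformation (Q v) Q
    (S v) r s r)
  + (\sum_r \sum_l mink r * disformation Q r l r * (mink l * disformation Q l s v))
  - (\sum_r \sum_l mink r * disformation Q r l v * (mink l * disformation Q l s r)).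

Lemma nonmetricity_of_disformation Q : (forall i j k, Q i j k = Q i k j) ->
  nonmetricity_of (disformation Q) = Q.
Proof.
move=> hQ; apply/funext => i; apply/funext => j; apply/funext => k.
by rewrite /nonmetricity_of /disformation (hQ k j i) (hQ j k i) (hQ i k j); field.
Qed.

Lemma sym23E (n : tensor3 R) : (forall i j k, n i j k = n i k j) -> sym23 n = n.
Proof.
move=> hn; apply/funext => i; apply/funext => j; apply/funext => k.
by rewrite /sym23; case: ifP.
Qed.

Lemma sym_secondE S : (forall l i j k, S l i j k = S l i k j) ->
  (forall l i j k, S l i j k = S i l j k) -> sym_second S = S.
Proof.
move=> h1 h2; do 4![apply/funext => ?]; rewrite /sym_second !sym23E //; case: ifP => // _.
Qed.

Lemma superpotential_minkowski Q : (forall i j k, Q i j k = Q i k j) ->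
  superpotential minkowski Q =
    frame_superpotential (disformation Q) (fun i => \sum_l mink l * disformation Q l l i)
    (fun i => \sum_l mink l * disformation Q i l l).
Proof.
move=> hQ; apply/funext => r; apply/funext => m; apply/funext => v.
rewrite /superpotential invmx_minkowski !move3E !act3_minkowski !move1_minkowski
  !minkowskiE.
rewrite !trace23_minkowski !trace13_minkowski.
(* With a and b the two traces of the disformation, Q_i = 2 a_i and, below, tilde Q_i = a_i +
   b_i. *)
have h23 i : ftrace23 Q i = 2 * \sum_l mink l * disformation Q l l i.
  by rewrite mulr_sumr; apply: eq_bigr => l _; rewrite /disformation; field.
have h13 i : ftrace13 Q i =
  \sum_l mink l * disformation Q i l l + \sum_l mink l * disformation Q l l i.
  by rewrite -big_split; apply: eq_bigr => l _ /=; rewrite /disformation; field.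
by rewrite !h23 !h13 /frame_superpotential /disformation (hQ m v r) (hQ v m r); field.
Qed.

Lemma stegr_potential_minkowski Y m v :
  stegr_potential Y minkowski m v = frame_potential Y (ftrace23 Y) (ftrace13 Y) m v.
Proof.
have t23E : trace23 minkowski Y = ftrace23 Y by apply/funext => a;
  exact: trace23_minkowski.
have t13E : trace13 minkowski Y = ftrace13 Y by apply/funext => a;
  exact: trace13_minkowski.
have mE (w : tensor1 R) : move1 minkowski w = fun a => mink a * w a.
  by apply/funext => a; exact: move1_minkowski.
have PdE : move3 minkowski Y = fun a b c => mink a * mink b * mink c * Y a b c.
  by do 3![apply/funext => ?]; rewrite move3E act3_minkowski.
have PmE : move13 minkowski Y = fun a b c => mink a * mink c * Y a b c.
  apply/funext => a; apply/funext => b; apply/funext => c.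
  rewrite /move13; transitivity (\sum_d minkowski a d * (\sum_f minkowski c f * Y d b f)).
    by apply: eq_bigr => d _; rewrite mulr_sumr; apply: eq_bigr => f _; rewrite mulrA.
  by rewrite (sum_minkowski a
    (fun d => \sum_f minkowski c f * Y d b f)) (sum_minkowski c (fun f => Y a b f)) mulrA.
by rewrite /stegr_potential /frame_potential /symmetrize /dot t23E t13E
  !mE invmx_minkowski minkowskiE PdE PmE.
Qed.

Lemma frame_superpotential_traces (n : tensor3 R) r :
  let a := fun i => \sum_l mink l * n l l i in
  let b := fun i => \sum_l mink l * n i l l in
  (forall i j k, n i j k = n i k j) ->
  ftrace23 (frame_superpotential n a b) r = mink r * (a r - b r) /\
  ftrace13 (frame_superpotential n a b) r = mink r * (- a r - 2^-1 * b r).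
Proof.
move=> a b hn; rewrite -(sym23E hn) in a b *.
rewrite /ftrace23 /ftrace13 /frame_superpotential /a /b !sum_ord4.
have t1 : (2:R) != 0 by rewrite pnatr_eq0.
by move: r; apply: forall_ord4; split;
  cbv [mink frame_metric sym23 Nat.leb Nat.eqb nat_of_ord o0 o1 o2 o3]; field.
Qed.

(** Arrays with the required symmetries are fixed by [sym23] and [sym_second], so
    [frame_identity_sym] applies to them. *)
Lemma frame_identity Q S m v :
  (forall i j k, Q i j k = Q i k j) -> (forall l i j k, S l i j k = S l i k j) ->
  (forall l i j k, S l i j k = S i l j k) ->
  let Y := superpotential minkowski Q in
  mink m * mink v * frame_ricci Q S m v - 2^-1 * frame_metric m v * \sum_a mink a *
    frame_ricci Q S a a =
  \sum_r d_superpotential (Q r) Q (S r) r m v + 2^-1 * (\sum_r ftrace23 Q r * Y r m v)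
  + 4 * stegr_potential Y minkowski m v.
Proof.
move=> hQ hS hT Y.
have hn i j k : disformation Q i j k =
  disformation Q i k j by rewrite /disformation (hQ i j k); ring.
have := frame_identity_sym S (disformation Q) m v;
  rewrite /= (sym23E hn) (sym_secondE hS hT) /frame_identity_for
    nonmetricity_of_disformation //.
have ricE s w : frame_ricci_of (disformation Q) S s w = frame_ricci Q S s w.
  by rewrite /frame_ricci_of /frame_ricci nonmetricity_of_disformation.
rewrite ricE; under [in LHS]eq_bigr do rewrite ricE.
move=> ->; rewrite -superpotential_minkowski // -/Y stegr_potential_minkowski.
congr (_ + _ + 4 * _).
  rewrite mulr_sumr; apply: eq_bigr => r _; rewrite mulrA; congr (_ * _).
  by rewrite /ftrace23 !mulr_sumr; apply: eq_bigr => l _; rewrite /disformation; field.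
have -> : ftrace23 Y = fun r => mink r *
  (\sum_l mink l * disformation Q l l r - \sum_l mink l * disformation Q r l l).
  by apply/funext => r; rewrite /Y superpotential_minkowski //;
    have [] := frame_superpotential_traces r hn.
have -> // : ftrace13 Y = fun r => mink r * (-
  (\sum_l mink l * disformation Q l l r) - 2^-1 * \sum_l mink l * disformation Q r l l).
by apply/funext => r; rewrite /Y superpotential_minkowski //;
  have [] := frame_superpotential_traces r hn.
Qed.

End FrameIdentity.

(** * Infinitesimal action of GL(4) *)

Section CovariantFrames.
Context {R : realType}.
Implicit Types (M MA MB MC A B C P g : 'M[R]_4) (Y : tensor3 R).

(** The derivative of [act3] at the identity. With plus or minus the matrix of Gamma_mu it produces
    the connection terms of a covariant derivative. *)
Definition gl_act3 MA MB MC Y : tensor3 R := fun a b c =>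
  \sum_d MA a d * Y d b c + \sum_d MB b d * Y a d c + \sum_d MC c d * Y a b d.

Lemma act3_mid M Y a b c : act3 1%:M M 1%:M Y a b c = \sum_d M b d * Y a d c.
Proof.
by rewrite act3_swap12 -[M]mulmx1 -contract1_act3 mulmx1; apply: eq_bigr => d _;
  rewrite act3_1.
Qed.

Lemma act3_left M Y a b c : act3 M 1%:M 1%:M Y a b c = \sum_d M a d * Y d b c.
Proof.
by rewrite -[M]mulmx1 -contract1_act3 mulmx1; apply: eq_bigr => d _; rewrite act3_1.
Qed.

Lemma act3_right M Y a b c : act3 1%:M 1%:M M Y a b c = \sum_d M c d * Y a b d.
Proof. by rewrite act3_swap23 act3_mid. Qed.

Lemma gl_act3E MA MB MC Y a b c : gl_act3 MA MB MC Y a b c =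
  act3 MA 1%:M 1%:M Y a b c + act3 1%:M MB 1%:M Y a b c + act3 1%:M 1%:M MC Y a b c.
Proof. by rewrite act3_mid act3_left act3_right. Qed.

(** For a moving frame: the logarithmic derivatives on the left act on the tensor already expressed
    in coordinates. *)
Lemma act3_derives_left (A B C : R -> 'M[R]_4) Z MA MB MC dZ :
  mx_derives A (MA *m A 0) -> mx_derives B (MB *m B 0) -> mx_derives C (MC *m C 0) ->
  tensor_derives Z dZ ->
  tensor_derives (fun t => act3 (A t) (B t) (C t) (Z t))
    (fun a b c => gl_act3 MA MB MC (act3 (A 0) (B 0) (C 0) (Z 0)) a b c
                  + act3 (A 0) (B 0) (C 0) dZ a b c).
Proof.
move=> hA hB hC hZ a b c.
apply: (is_derive_eq (act3_derives hA hB hC hZ a b c)).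
by rewrite gl_act3E !act3_comp !mul1mx.
Qed.

(** The counterpart for passing from coordinates to frame components, where the logarithmic
    derivatives combine with [dZ] into a covariant derivative. *)
Lemma act3_derives_right (A B C : R -> 'M[R]_4) Z MA MB MC dZ :
  mx_derives A (A 0 *m MA) -> mx_derives B (B 0 *m MB) -> mx_derives C (C 0 *m MC) ->
  tensor_derives Z dZ ->
  tensor_derives (fun t => act3 (A t) (B t) (C t) (Z t))
    (act3 (A 0) (B 0) (C 0) (fun a b c => gl_act3 MA MB MC (Z 0) a b c + dZ a b c)).
Proof.
move=> hA hB hC hZ a b c.
apply: (is_derive_eq (act3_derives hA hB hC hZ a b c)).
rewrite -act3D; congr (_ + _).
have -> : gl_act3 MA MB MC (Z 0) = fun a b c => act3 MA 1%:M 1%:M (Z 0) a b c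
    + act3 1%:M MB 1%:M (Z 0) a b c + act3 1%:M 1%:M MC (Z 0) a b c.
  by do 3![apply/funext => ?]; rewrite gl_act3E.
by rewrite -!act3D !act3_comp !mulmx1.
Qed.

Lemma disformation_act3 A Y : disformation (act3 A A A Y) = act3 A A A (disformation Y).
Proof.
apply/funext => l; apply/funext => m; apply/funext => v.
rewrite /disformation (act3_swap12 _ _ _ _ m l v).
rewrite (act3_rot _ _ m v l) (act3_rot _ _ l m v) act3N !act3D act3Z.
by congr (act3 _ _ _ _ _ _ _); do 3![apply/funext => ?].
Qed.

Lemma diff_tensor_act3 g P Q : g \in unitmx -> P \in unitmx ->
  diff_tensor (invmx g) Q =
  act3 P (invmx P)^T (invmx P)^T
    (diff_tensor (invmx (P^T *m g *m P)) (move3 P^T Q)).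
Proof.
move=> gu Pu; rewrite invmx_congr // /diff_tensor move3E disformation_act3 !act3_comp.
have Ptu : P^T \in unitmx by rewrite unitmx_tr.
rewrite !mulmxA mulmxV // !mul1mx mulmxKV // !mulmx1 -trmx_mul.
by rewrite mulmxV // trmx1.
Qed.

(** Taking determinants, (det P)^2 det g = -1. *)
Lemma det_lorentz_neg g P : P \in unitmx -> P^T *m g *m P = minkowski -> \det g < 0.
Proof.
move=> Pu /(congr1 determinant); rewrite !det_mulmx det_tr => E.
have : \det P ^+ 2 * \det g = -1.
  rewrite expr2 -mulrA [\det P * \det g]mulrC mulrA E /minkowski det_diag big_ord_recl.
  rewrite big1 => [|i _]; first by rewrite mxE eqxx mulr1.
  by rewrite mxE.
have : 0 < \det P ^+ 2 by rewrite exprn_even_gt0 //= -unitfE -unitmxE.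
by move=> h1 h2; rewrite -(pmulr_rlt0 _ h1) h2 ltrN10.
Qed.

End CovariantFrames.

(** * Metric derivative of the Hamiltonian *)

Section HamiltonianDerivative.
Context {R : realType}.
Variables (g : 'M[R]_4) (Pi : tensor3 R).
Hypothesis g_symm : g^T = g.
Hypothesis g_neg : \det g < 0.
Hypothesis Pi_sym : forall a b c, Pi a b c = Pi a c b.
Variable h : 'M[R]_4.
Hypothesis h_symm : h^T = h.

Local Notation derives f df := (is_derive (0 : R) (1 : R) (f : R -> R) df).

(** The value on the direction [h] of a differential with coefficients [T]. As [h] is symmetric, it
    only depends on the symmetric part of [T]. *)
Definition pairing (T : tensor2 R) := \sum_m \sum_n T m n * h m n.

Lemma pairingD T U : pairing T + pairing U = pairing (fun m n => T m n + U m n).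
Proof.
rewrite /pairing -big_split; apply: eq_bigr => m _ /=.
by rewrite -big_split; apply: eq_bigr => n _ /=; rewrite mulrDl.
Qed.

Lemma pairingZ k T : k * pairing T = pairing (fun m n => k * T m n).
Proof.
rewrite /pairing mulr_sumr; apply: eq_bigr => m _.
by rewrite mulr_sumr; apply: eq_bigr => n _; rewrite mulrA.
Qed.

Lemma pairingN T : - pairing T = pairing (fun m n => - T m n).
Proof.
rewrite -mulN1r pairingZ; congr pairing.
by apply/funext => m; apply/funext => n; rewrite mulN1r.
Qed.

Lemma h_sym m n : h m n = h n m.
Proof. by rewrite -[in LHS]h_symm mxE. Qed.

Lemma pairing_tr T : pairing T = pairing (fun m n => T n m).
Proof.
rewrite /pairing exchange_big; apply: eq_bigr => m _; apply: eq_bigr => n _ /=.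
by rewrite h_sym.
Qed.

Lemma pairing_symmetrize T : pairing (symmetrize T) = pairing T.
Proof.
rewrite /symmetrize -pairingZ -pairingD -[pairing (fun m n => T n m)]pairing_tr.
by field.
Qed.

Lemma slot1_sym a : (slot1 Pi a)^T = slot1 Pi a.
Proof. by apply/matrixP => b c; rewrite !mxE. Qed.

Lemma cubic_left : \sum_r \sum_m \sum_n Pi r m n * act3 h g g Pi m n r =
  pairing (fun m n => \sum_a \sum_b Pi m a b * move13 g Pi a n b).
Proof.
transitivity (\sum_m \tr (slot2 Pi m *m slot1 (act3 h g g Pi) m)).
  rewrite exchange_big; apply: eq_bigr => m _ /=; apply: eq_bigr => r _.
  by rewrite mxE; apply: eq_bigr => n _; rewrite !mxE.
rewrite pairing_tr; apply: eq_bigr => m _.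
rewrite slot1_act3 mulmx_sumr raddf_sum; apply: eq_bigr => d _ /=.
rewrite contract_slot12 slot1_sym slot2_move13 g_symm -scalemxAr mxtraceZ mulrC.
by congr (_ * _); rewrite mxtrace_mulC -!mulmxA mxtrace_mulC !mulmxA.
Qed.

Lemma cubic_mid : \sum_r \sum_m \sum_n Pi r m n * act3 g h g Pi m n r =
  pairing (fun m n => \sum_a \sum_b Pi a m b * move13 g Pi b n a).
Proof.
transitivity (\sum_n \sum_r \sum_m Pi r n m * act3 g h g Pi m n r).
  rewrite [RHS]exchange_big; apply: eq_bigr => r _ /=.
  rewrite exchange_big; apply: eq_bigr => n _; apply: eq_bigr => m _ /=.
  by rewrite Pi_sym.
apply: eq_bigr => n _; rewrite contract_slot22 slot2_act3 mulmx_sumr raddf_sum.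
apply: eq_bigr => e _ /=.
by rewrite contract_slot22 slot2_move13 -scalemxAr mxtraceZ mulrC.
Qed.

(** Symmetry of [Pi] in its last two indices gives the same value as [cubic_left]. This doubling
    explains the coefficients 1/2 and 1/4 of the first two terms of V. *)
Lemma cubic_right : \sum_r \sum_m \sum_n Pi r m n * act3 g g h Pi m n r =
  pairing (fun m n => \sum_a \sum_b Pi m a b * move13 g Pi a n b).
Proof.
have PiE : (fun a b c => Pi a c b) = Pi.
  by do 3![apply/funext => ?].
transitivity (\sum_r \sum_m \sum_n Pi r m n * act3 g h g Pi m r n).
  do 3![apply: eq_bigr => ? _].
  by rewrite act3_swap23 PiE.
apply: eq_bigr => r _; rewrite contract_slot12 slot2_act3 mulmx_sumr raddf_sum.
apply: eq_bigr => e _ /=.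
by rewrite contract_slot12 slot2_move13 -scalemxAr mxtraceZ mulrC.
Qed.

Lemma dot_move_pairing v w : dot v (move1 h w) = pairing (fun m n => v m * w n).
Proof.
apply: eq_bigr => m _; rewrite mulr_sumr; apply: eq_bigr => n _; ring.
Qed.

Lemma dot_trace23_pairing u :
  dot (trace23 h Pi) u = pairing (fun m n => \sum_a u a * Pi a m n).
Proof.
rewrite /dot /trace23; under eq_bigr do rewrite mulr_suml.
rewrite exchange_big; apply: eq_bigr => m _ /=.
under eq_bigr do rewrite mulr_suml.
rewrite exchange_big; apply: eq_bigr => n _ /=; rewrite mulr_suml.
by apply: eq_bigr => a _; ring.
Qed.

Lemma dot_trace13_pairing u :
  dot (trace13 h Pi) u = pairing (fun m n => \sum_a u a * Pi m n a).
Proof.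
rewrite /dot /trace13; under eq_bigr do rewrite mulr_suml.
rewrite exchange_big; apply: eq_bigr => m _ /=.
under eq_bigr do rewrite mulr_suml.
rewrite exchange_big; apply: eq_bigr => n _ /=; rewrite mulr_suml.
by apply: eq_bigr => a _; rewrite (Pi_sym m a n); ring.
Qed.

Lemma dot_comm (v w : tensor1 R) : dot v w = dot w v.
Proof. by apply: eq_bigr => a _; rewrite mulrC. Qed.

Lemma dot_g v w : dot v (move1 g w) = dot w (move1 g v).
Proof. by rewrite dot_comm dot_move1 g_symm. Qed.

Definition momentum_square (A : 'M[R]_4) : R :=
  \sum_rho \sum_mu \sum_nu Pi rho mu nu * move3 A Pi mu nu rho
  + 6^-1 * dot (trace23 A Pi) (move1 A (trace23 A Pi))
  - 2 / 3 * dot (trace23 A Pi) (move1 A (trace13 A Pi))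
  - 3^-1 * dot (trace13 A Pi) (move1 A (trace13 A Pi)).

(** The symmetrizations disappear against [h], and the bracket multiplying the inverse metric is
    -1/8 of [momentum_square g]. *)
Lemma pairing_stegr_potential : pairing (fun m n => stegr_potential Pi g m n) =
  4^-1 * pairing (fun m n => \sum_a \sum_b Pi a m b * move13 g Pi b n a)
  + 2^-1 * pairing (fun m n => \sum_a \sum_b Pi m a b * move13 g Pi a n b)
  + 24^-1 * pairing (fun m n => trace23 g Pi m * trace23 g Pi n)
  - 12^-1 * pairing (fun m n => trace13 g Pi m * trace13 g Pi n)
  - 6^-1 * pairing (fun m n => trace23 g Pi m * trace13 g Pi n)
  + 12^-1 * pairing (fun m n => \sum_a move1 g (trace23 g Pi) a * Pi a m n)
  - 6^-1 * pairing (fun m n => \sum_a move1 g (trace13 g Pi) a * Pi a m n)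
  - 6^-1 * pairing (fun m n => \sum_a move1 g (trace23 g Pi) a * Pi m n a)
  - 6^-1 * pairing (fun m n => \sum_a move1 g (trace13 g Pi) a * Pi m n a)
  - 8^-1 * momentum_square g * pairing (fun m n => invmx g m n).
Proof.
have sE u m n : \sum_a u a * symmetrize (fun m n => Pi m n a) m n =
    symmetrize (fun m n => \sum_a u a * Pi m n a) m n.
  rewrite /symmetrize -big_split mulr_sumr; apply: eq_bigr => a _ /=; ring.
rewrite -[pairing (fun m n => \sum_a \sum_b Pi m a b * _)]pairing_symmetrize.
rewrite -[pairing (fun m n => trace23 g Pi m * trace13 g Pi n)]pairing_symmetrize.
rewrite -[pairing (fun m n => \sum_a move1 g
  (trace23 g Pi) a * Pi m n a)]pairing_symmetrize.
rewrite -[pairing (fun m n => \sum_a move1 g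
  (trace13 g Pi) a * Pi m n a)]pairing_symmetrize.
rewrite !(pairingZ, pairingN, pairingD); congr pairing.
apply/funext => m; apply/funext => n; rewrite /stegr_potential !sE.
by rewrite /momentum_square; field.
Qed.

(** The line through [g] in direction [h], in the shape required by [is_derive_lineP]. *)
Let A (t : R) : 'M[R]_4 := t *: h + g.

Let A0 : A 0 = g. Proof. by rewrite /A scale0r add0r. Qed.

Lemma line_derives : mx_derives A h.
Proof.
move=> i j; rewrite (_ : (fun t => _) = fun t => h i j * t + g i j).
  apply: (is_derive_eq (is_derive_add (is_derive_scale (h i j) (is_derive_id
    (0 : R) 1)) (is_derive_cst (g i j) (0 : R) 1))).
  by rewrite mulr1 addr0.
by apply/funext => t; rewrite !mxE mulrC.
Qed.

Lemma dot_move_derives (v w : R -> tensor1 R) dv dw :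
  (forall a, derives (fun t => v t a) (dv a)) ->
    (forall a, derives (fun t => w t a) (dw a)) ->
  derives (fun t => dot (v t) (move1 (A t) (w t)))
    (dot dv (move1 g (w 0)) + dot (v 0) (move1 h (w 0)) + dot (v 0) (move1 g dw)).
Proof.
move=> hv hw; rewrite /dot -!big_split /=.
apply: is_derive_bigsum => a.
have hm : derives (fun t => move1 (A t) (w t) a) (move1 h (w 0) a + move1 g dw a).
  rewrite /move1 -big_split /=; apply: is_derive_bigsum => b.
  by have := is_derive_mul (line_derives a b) (hw b); rewrite A0.
apply: (is_derive_eq (is_derive_mul (hv a) hm)).
by rewrite A0 mulrDr addrA.
Qed.

Lemma momentum_square_derives : derives (fun t => momentum_square (A t))
  (4 * pairing (fun m n => stegr_potential Pi g m n)
   + 2^-1 * \tr (h *m invmx g) * momentum_square g).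
Proof.
have gu : g \in unitmx by rewrite unitmxE unitfE lt_eqF.
have h23 r : derives (fun t => trace23 (A t) Pi r) (trace23 h Pi r).
  apply: is_derive_bigsum => l; apply: is_derive_bigsum => k.
  apply: (is_derive_eq (is_derive_mul (line_derives l k) (is_derive_cst (Pi r l k)
    (0 : R) 1))).
  by rewrite mulr0 addr0.
have h13 r : derives (fun t => trace13 (A t) Pi r) (trace13 h Pi r).
  apply: is_derive_bigsum => l; apply: is_derive_bigsum => k.
  apply: (is_derive_eq (is_derive_mul (line_derives l k) (is_derive_cst (Pi l r k)
    (0 : R) 1))).
  by rewrite mulr0 addr0.
have hPi : tensor_derives (fun=> Pi) (fun _ _ _ => 0 : R).
  by move=> a b c; exact: is_derive_cst.
have h3 : derives (fun t => \sum_r \sum_m \sum_n Pi r m n * move3 (A t) Pi m n r)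
    (\sum_r \sum_m \sum_n Pi r m n * act3 h g g Pi m n r
     + \sum_r \sum_m \sum_n Pi r m n * act3 g h g Pi m n r
     + \sum_r \sum_m \sum_n Pi r m n * act3 g g h Pi m n r).
  rewrite -!big_split; apply: is_derive_bigsum => r /=.
  rewrite -!big_split; apply: is_derive_bigsum => m /=.
  rewrite -!big_split; apply: is_derive_bigsum => n /=.
  apply: (is_derive_eq (is_derive_scale _
    (act3_derives line_derives line_derives line_derives hPi m n r))).
  rewrite A0 -!mulrDr; congr (_ * _).
  have -> : act3 g g g (fun _ _ _ => 0) m n r = 0; last by rewrite addr0.
  by rewrite /act3 !big1 // => ? _; rewrite !big1 // => ? _; rewrite !big1 // => ? _;
    rewrite mulr0.
rewrite cubic_left cubic_mid cubic_right in h3.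
have h4 := is_derive_scale 6^-1 (dot_move_derives h23 h23).
have h5 := is_derive_scale (2 / 3) (dot_move_derives h23 h13).
have h6 := is_derive_scale 3^-1 (dot_move_derives h13 h13).
apply: (is_derive_eq (is_derive_sub (is_derive_sub (is_derive_add h3 h4) h5) h6)).
(* Symmetry of [g] brings every varied trace into the first factor of its product. *)
rewrite A0 !(dot_g _ (trace23 h Pi)) !(dot_g _ (trace13 h Pi)).
rewrite !dot_trace23_pairing !dot_trace13_pairing !dot_move_pairing.
have trE : \tr (h *m invmx g) = pairing (fun m n => invmx g m n).
  apply: eq_bigr => m _; rewrite mxE; apply: eq_bigr => n _.
  have -> : invmx g m n = invmx g n m.
    by rewrite -[in LHS]g_symm -trmx_inv mxE.
  exact: mulrC.
rewrite trE [2^-1 * _]mulrC -mulrA [pairing (fun m n => invmx g m n) * _]mulrC.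
by rewrite pairing_stegr_potential /momentum_square; field.
Qed.

(** The derivative of 1 / vol cancels the trace term of [momentum_square_derives], and - kappa^2 /
    (2 vol) times 4 V remains. *)
Lemma hamiltonian_derives kappa :
  derives (fun t => stegr_hamiltonian kappa (A t) Pi)
    (pairing (fun m n => - (2 * kappa ^+ 2 / vol g) * stegr_potential Pi g m n)).
Proof.
have v0 : vol g != 0 by rewrite gt_eqF // sqrtr_gt0 oppr_gt0.
have gA : \det (A 0) < 0 by rewrite A0.
have hv := is_derive_vol line_derives gA; rewrite A0 in hv.
have v0' : 2 * vol (A 0) != 0 by rewrite A0 mulf_neq0 ?pnatr_eq0.
have hi := is_derive_scale (- kappa ^+ 2) (@is_derive_invf _ _
  (fun t => 2 * vol (A t)) 0 1 _ v0' (is_derive_scale 2 hv)).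
have hm := is_derive_mul hi momentum_square_derives.
rewrite (_ : (fun t => _) =
  fun t => - kappa ^+ 2 * (2 * vol (A t))^-1 * momentum_square (A t)).
  apply: (is_derive_eq hm); rewrite A0 -pairingZ; field.
  by rewrite v0.
by apply/funext => t; rewrite /stegr_hamiltonian !mulNr.
Qed.

End HamiltonianDerivative.

Lemma stegr_potential_sym (R : realType) (g : 'M[R]_4) (Pi : tensor3 R) m n :
  g^T = g -> (forall a b c, Pi a b c = Pi a c b) ->
  stegr_potential Pi g m n = stegr_potential Pi g n m.
Proof.
move=> gT Ps; rewrite /stegr_potential.
have giT : invmx g m n = invmx g n m by rewrite -[in LHS]gT -trmx_inv mxE.
have B1 : \sum_al \sum_be Pi al m be * move13 g Pi be n al =
    \sum_al \sum_be Pi al n be * move13 g Pi be m al.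
  rewrite !contract_slot22 !slot2_move13 gT.
  by rewrite mxtrace_mulC -!mulmxA mxtrace_mulC -!mulmxA mxtrace_mulC !mulmxA.
have sC (T : tensor2 R) : symmetrize T m n =
  symmetrize T n m by rewrite /symmetrize addrC.
have sE (u : tensor1 R) : \sum_al u al * Pi al m n = \sum_al u al * Pi al n m.
  by apply: eq_bigr => al _; rewrite Ps.
have sS' (u : tensor1 R) : \sum_al u al * symmetrize (fun m n => Pi m n al) m n =
    \sum_al u al * symmetrize (fun m n => Pi m n al) n m.
  by apply: eq_bigr => al _; rewrite /symmetrize addrC.
rewrite B1 giT !sE !sS' ![symmetrize _ m n]sC.
by rewrite [trace23 g Pi m * trace23 _ _ _]mulrC [trace13 g Pi m * trace13 _ _ _]mulrC.
Qed.

Lemma stegr_metric_derivative (R : realType) (kappa : R) (g : 'M[R]_4) (Pi : tensor3 R) :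
  g^T = g -> \det g < 0 -> (forall a b c, Pi a b c = Pi a c b) ->
  is_metric_derivative (fun h => stegr_hamiltonian kappa h Pi) g
    (\matrix_(m, n) (- (2 * kappa ^+ 2 / vol g) * stegr_potential Pi g m n)).
Proof.
move=> gT gN Ps; split.
  by apply/matrixP => m n; rewrite !mxE stegr_potential_sym.
move=> h hT; apply: (is_derive_lineP (fun h => stegr_hamiltonian kappa h Pi) g h _).2.
apply: (is_derive_eq (hamiltonian_derives gT gN Ps hT kappa)).
by apply: eq_bigr => m _; apply: eq_bigr => n _; rewrite mxE.
Qed.

(** * Covariant derivatives and curvature in a parallel frame *)

Section Fields.
Context {R : realType}.
Variables (Gam : 'rV[R]_4 -> tensor3 R) (g : 'rV[R]_4 -> 'M[R]_4).
Variables (U : set 'rV[R]_4) (x : 'rV[R]_4).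
Hypothesis U_open : open U.
Hypothesis Ux : U x.
Hypothesis g_lorentz : forall y, U y -> lorentzian (g y).
Hypothesis Gam_sym : forall y, U y -> forall a b c, Gam y a b c = Gam y a c b.
Hypothesis Gam_flat : forall a b c d, curvature Gam x a b c d = 0.
Hypothesis Gam_diff : forall a b c, differentiable (fun y => Gam y a b c) x.
Hypothesis g_diff : forall a b, differentiable (fun y => g y a b) x.
Hypothesis dg_diff : forall d a b, differentiable (partial d (fun y => g y a b)) x.
Hypothesis ddg_sym : forall c d a b,
  partial c (partial d (fun y => g y a b)) x = partial d (partial c (fun y => g y a b)) x.

Local Notation Q := (nonmetricity Gam g).
Local Notation dg c a b := (partial c (fun y => g y a b) x).
Local Notation G := (Gam x).

Definition axis (mu : 'I_4) (t : R) : 'rV[R]_4 := t *: delta_mx 0 mu + x.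

Lemma axis0 mu : axis mu 0 = x. Proof. by rewrite /axis scale0r add0r. Qed.

Lemma axis_derive mu (f : 'rV[R]_4 -> R) : differentiable f x ->
  is_derive (0 : R) 1 (fun t => f (axis mu t)) (partial mu f x).
Proof. move=> hf; apply: (is_derive_lineP f x (delta_mx 0 mu) _).1;
  apply: derivableP; exact: diff_derivable. Qed.

Lemma partial_axis mu (f : 'rV[R]_4 -> R) df :
  is_derive (0 : R) 1 (fun t => f (axis mu t)) df -> partial mu f x = df.
Proof. by move=> h; have [] := (is_derive_lineP f x (delta_mx 0 mu) df).2 h. Qed.

Lemma near_axis mu : \forall t \near (0 : R), U (axis mu t).
Proof.
have c : axis mu t @[t --> (0 : R)] --> axis mu 0.
  by apply: cvgD; [exact: scalel_continuous | exact: cvg_cst].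
by apply: c; rewrite axis0; exact: open_nbhs_nbhs.
Qed.

Lemma near_x (P : 'rV[R]_4 -> Prop) : (forall y, U y -> P y) -> \forall y \near x, P y.
Proof. by move=> h; apply: filterS h _; exact: open_nbhs_nbhs. Qed.

Lemma g_sym y : U y -> forall a b, g y a b = g y b a.
Proof. by move=> Uy a b; have [gT _] := g_lorentz Uy; rewrite -[in RHS]gT mxE. Qed.

Lemma g_unit y : U y -> g y \in unitmx.
Proof.
move=> Uy; have [_ [P [Pu E]]] := g_lorentz Uy.
have := @minkowski_unit R; rewrite -/minkowski in E; rewrite -E !unitmx_mul.
by case/andP => /andP[].
Qed.

Lemma partial_g_sym y : U y -> forall c a b,
  partial c (fun y => g y a b) y = partial c (fun y => g y b a) y.
Proof.
move=> Uy c a b; apply: near_eq_derive.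
have : nbhs y U by exact: open_nbhs_nbhs.
by apply: filterS => z Uz; exact: g_sym.
Qed.

Lemma Q_sym y : U y -> forall a b c, Q y a b c = Q y a c b.
Proof.
move=> Uy a b c; rewrite /nonmetricity (partial_g_sym Uy a b c) addrAC.
congr (_ - _ - _); apply: eq_bigr => l _; congr (_ * _); exact: g_sym.
Qed.

Lemma Q_diff a b c : differentiable (fun y => Q y a b c) x.
Proof.
have S (h k : 'I_4 -> 'rV[R]_4 -> R) : (forall i, differentiable (h i) x) ->
    (forall i, differentiable (k i) x) ->
      differentiable (fun y => \sum_i h i y * k i y) x.
  move=> hh hk; rewrite (_ : (fun y => _) = \sum_i (h i * k i)).
    by apply: differentiable_sum => i; apply: differentiableM.
  by apply/funext => y; rewrite fct_sumE.
apply: differentiableB; first apply: differentiableB => //.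
  exact: S.
exact: S.
Qed.

Definition dQ mu a b c := partial mu (fun y => Q y a b c) x.

Definition Gmx mu : 'M[R]_4 := \matrix_(a, b) G a b mu.

(** nabla_mu Q_{abc}: each lower index contributes a term with minus the transpose of Gamma_mu. *)
Definition covQ mu : tensor3 R := fun a b c =>
  gl_act3 (- (Gmx mu)^T) (- (Gmx mu)^T) (- (Gmx mu)^T) (Q x) a b c + dQ mu a b c.

Lemma covQ_sym23 mu a b c : covQ mu a b c = covQ mu a c b.
Proof.
rewrite /covQ /gl_act3; congr (_ + _).
  rewrite addrAC; congr (_ + _ + _); apply: eq_bigr => d _; congr (_ * _); exact: Q_sym.
apply: near_eq_derive; exact: (near_x (fun y Uy => Q_sym Uy a b c)).
Qed.

Lemma dQE mu a b c : dQ mu a b c = partial mu (partial a (fun y => g y b c)) x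
  - \sum_l (partial mu (fun y => Gam y l b a) x * g x l c + G l b a * dg mu l c)
  - \sum_l (partial mu (fun y => Gam y l c a) x * g x b l + G l c a * dg mu b l).
Proof.
have D (f : 'rV[R]_4 -> R) : differentiable f x ->
  is_derive x (delta_mx 0 mu) f (partial mu f x).
  by move=> hf; apply: derivableP; exact: diff_derivable.
apply: derive_val; apply: is_derive_sub; first apply: is_derive_sub.
- exact: D.
- apply: is_derive_bigsum => l;
  apply: (is_derive_mul (D _ (Gam_diff l b a)) (D _ (g_diff l c))).
- apply: is_derive_bigsum => l;
  apply: (is_derive_mul (D _ (Gam_diff l c a)) (D _ (g_diff b l))).
Qed.

(** All connection terms cancel: the weight term against that of the contracted index, the terms of
    the free indices against those added in the covariant divergence. *)
Lemma divergence_algebra (G s : tensor3 R) (q z : tensor1 R) a b :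
  \sum_r ((2^-1 * q r + \sum_l G l r l) * s r a b + (- \sum_d G r d r * s d a b
    - \sum_d G a d r * s r d b - \sum_d G b d r * s r a d + z r))
  + \sum_r \sum_l G a l r * s r l b + \sum_r \sum_l G b l r * s r a l
  = \sum_r z r + 2^-1 * \sum_r q r * s r a b.
Proof. by rewrite !sum_ord4; ring. Qed.

(** Koszul's formula with partial derivatives of g replaced by Q plus connection terms; symmetry of
    [G] leaves a single term. *)
Lemma christoffel_algebra (d G : tensor3 R) (gx : 'M[R]_4) :
  (forall a b c, G a b c = G a c b) -> (forall a b, gx a b = gx b a) -> forall l b c,
  2^-1 * (d b l c + d c l b - d l b c) =
  disformation (fun a b c => d a b c - \sum_k G k b a * gx k c - \sum_k G k c a * gx
    b k) l b c
  + move1 gx (fun k => G k b c) l.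
Proof.
move=> hG hg l b c; rewrite /disformation /move1 !sum_ord4.
rewrite !(hG _ c b) !(hG _ b l) !(hG _ c l) !(hg b _).
by field.
Qed.

(** The curvature of a sum of a connection and a tensor. With [D] the covariant derivative of [N],
    the mixed terms cancel, one pair of them by symmetry of [G]. *)
Lemma curvature_algebra (G N : tensor3 R) (e D : 'I_4 -> tensor3 R) :
  (forall a b c, G a b c = G a c b) -> forall a b m n,
  let dC m a b n := e m a b n + (- \sum_d G a d m * N d b n
    + \sum_d G d b m * N a d n + \sum_d G d n m * N a b d + D m a b n) in
  dC m a b n - dC n a b m + \sum_l (G a l m + N a l m) * (G l b n + N l b n)
    - \sum_l (G a l n + N a l n) * (G l b m + N l b m)
  = (e m a b n - e n a b m + \sum_l G a l m * G l b n - \sum_l G a l n * G l b m)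
    + (D m a b n - D n a b m + \sum_l N a l m * N l b n - \sum_l N a l n * N l b m).
Proof.
move=> hG a b m n dC; rewrite /dC !sum_ord4 !(hG _ n m).
by ring.
Qed.

Lemma covQE mu a b c : covQ mu a b c = dQ mu a b c - \sum_l G l a mu * Q x l b c
  - \sum_l G l b mu * Q x a l c - \sum_l G l c mu * Q x a b l.
Proof.
rewrite /covQ /gl_act3 addrC !addrA -!sumrN.
by congr (_ + _ + _ + _); apply: eq_bigr => l _; rewrite !mxE mulNr.
Qed.

(** The commutator of two covariant derivatives of g. [dd] stands for the common second partial
    derivative and [z] for the term that zero torsion makes common to both orders. *)
Lemma ricci_identity_algebra (G d : tensor3 R) (e : 'I_4 -> tensor3 R) (gx : tensor2 R)
    (z dd : R) mu a b c :
  let q a b c := d a b c - \sum_l G l b a * gx l c - \sum_l G l c a * gx b l in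
  let dq mu a b c := dd - \sum_l (e mu l b a * gx l c + G l b a * d mu l c)
    - \sum_l (e mu l c a * gx b l + G l c a * d mu b l) in
  let r l b mu a := e mu l b a - e a l b mu + \sum_k G l k mu * G k b a
    - \sum_k G l k a * G k b mu in
  dq mu a b c - z - \sum_l G l b mu * q a l c - \sum_l G l c mu * q a b l
  - (dq a mu b c - z - \sum_l G l b a * q mu l c - \sum_l G l c a * q mu b l)
  = - (\sum_l r l b mu a * gx l c) - \sum_l r l c mu a * gx b l.
Proof.
move=> q dq r; rewrite /q /dq /r.
rewrite !sum_ord4.
ring.
Qed.

Lemma covQ_comm mu a b c : covQ mu a b c = covQ a mu b c.
Proof.
apply/eqP; rewrite -subr_eq0; apply/eqP.
transitivity (- (\sum_l curvature Gam x l b mu a * g x l c)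
   - \sum_l curvature Gam x l c mu a * g x b l); last first.
  by rewrite !big1 ?oppr0 ?addr0 // => l _; rewrite Gam_flat mul0r.
rewrite !covQE !dQE (ddg_sym a mu).
have -> : \sum_l G l mu a * Q x l b c = \sum_l G l a mu * Q x l b c.
  by apply: eq_bigr => l _; rewrite Gam_sym.
set Z := \sum_l G l a mu * Q x l b c.
exact: (ricci_identity_algebra G (fun c a b => dg c a b)
  (fun m a b c => partial m (fun y => Gam y a b c) x) (g x) Z).
Qed.

(** * The frame parallel to first order along a coordinate line *)

Variable P0 : 'M[R]_4.
Hypothesis P0_unit : P0 \in unitmx.
Hypothesis P0_frame : P0^T *m g x *m P0 = minkowski.

Definition frame mu (t : R) : 'M[R]_4 := (1%:M - t *: Gmx mu) *m P0.

Lemma frame0 mu : frame mu 0 = P0.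
Proof. by rewrite /frame scale0r subr0 mul1mx. Qed.

Lemma frame_derives mu : mx_derives (frame mu) (- Gmx mu *m frame mu 0).
Proof.
move=> a b; rewrite frame0 (_ : (fun t => _) = fun t => P0 a b - (Gmx mu *m P0) a b * t).
  apply: (is_derive_eq (is_derive_sub (is_derive_cst (P0 a b) (0 : R) 1)
    (is_derive_scale ((Gmx mu *m P0) a b) (is_derive_id (0 : R) 1)))).
  by rewrite mulr1 sub0r mulNmx [in RHS]mxE.
by apply/funext => t; rewrite /frame mulmxBl mul1mx -scalemxAl !mxE mulrC.
Qed.

Lemma near_frame_unit mu : \forall t \near (0 : R), frame mu t \in unitmx.
Proof.
apply: near_unitmx; last by rewrite frame0.
by move=> i j; have [] := frame_derives mu i j.
Qed.

(** The dual coframe moves by the opposite, transposed matrix; it carries the lower indices of N. *)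
Lemma frame_inv_derives mu :
  mx_derives (fun t => (invmx (frame mu t))^T) ((Gmx mu)^T *m (invmx (frame mu 0))^T).
Proof.
have u : frame mu 0 \in unitmx by rewrite frame0.
have := mx_derives_tr (mx_derives_inv (frame_derives mu) u).
by rewrite mulNmx mulmxN mulNmx opprK mulmxA mulmxK // trmx_mul.
Qed.

(* Components in the frame [P0] of Q and of its covariant derivative,         *)
(* whose derivative index is the first argument of [Sf].                     *)
Definition Qf : tensor3 R := move3 P0^T (Q x).
Definition Sf (i : 'I_4) : tensor3 R := fun a b c =>
  \sum_d P0 d i * move3 P0^T (covQ d) a b c.

Local Notation th := (invmx P0).

(** Duality of frame and coframe: a derivative index passes to the frame and back. *)
Lemma sum_th (mu : 'I_4) (f : 'I_4 -> R) : \sum_i th i mu * (\sum_d P0 d i * f d) = f mu.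
Proof.
under eq_bigr do rewrite mulr_sumr.
rewrite exchange_big (bigD1 mu) //= [X in _ + X]big1 => [|d dmu].
  rewrite addr0; under eq_bigr do rewrite mulrA [th _ _ * _]mulrC.
  rewrite -mulr_suml; have /matrixP/(_ mu mu) := mulmxV P0_unit.
  by rewrite !mxE eqxx => ->; rewrite mul1r.
under eq_bigr do rewrite mulrA [th _ _ * _]mulrC.
rewrite -mulr_suml; have /matrixP/(_ d mu) := mulmxV P0_unit.
by rewrite !mxE (negbTE dmu) => ->; rewrite mul0r.
Qed.

Lemma covQ_frame mu : move3 P0^T (covQ mu) = fun a b c => \sum_i th i mu * Sf i a b c.
Proof.
apply/funext => a; apply/funext => b; apply/funext => c.
by rewrite (sum_th mu (fun d => move3 P0^T (covQ d) a b c)).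
Qed.

Lemma Qf_derives mu : tensor_derives (fun t => move3 (frame mu t)^T (Q (axis mu t)))
  (fun a b c => \sum_i th i mu * Sf i a b c).
Proof.
rewrite -covQ_frame.
have hP : mx_derives (fun t => (frame mu t)^T) ((frame mu 0)^T *m - (Gmx mu)^T).
  have := mx_derives_tr (frame_derives mu).
  by rewrite trmx_mul [(- _)^T]raddfN.
have hQ : tensor_derives (fun t => Q (axis mu t)) (dQ mu).
  move=> a b c; exact: (axis_derive mu (Q_diff a b c)).
have := act3_derives_right hP hP hP hQ.
by rewrite frame0 axis0.
Qed.

Definition framed_metric mu (t : R) : 'M[R]_4 := (frame mu t)^T *m g
  (axis mu t) *m frame mu t.

Lemma framed_metric0 mu : framed_metric mu 0 = minkowski.
Proof. by rewrite /framed_metric frame0 axis0. Qed.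

(** The connection terms from the two frame factors complete the partial derivative of g to nabla_mu
    g = Q_mu. *)
Lemma framed_metric_derives mu : mx_derives (framed_metric mu) (\matrix_(a,
  b) \sum_i th i mu * Qf i a b).
Proof.
have hP := frame_derives mu.
have hg : mx_derives (fun t => g (axis mu t)) (\matrix_(a, b) dg mu a b).
  by move=> a b; rewrite mxE; exact: (axis_derive mu (g_diff a b)).
have := mx_derives_mul (mx_derives_mul (mx_derives_tr hP) hg) hP.
rewrite !frame0 !axis0; congr (mx_derives _ _).
have -> : \matrix_(a, b) (\sum_i th i mu * Qf i a b) = P0^T *m slot1 (Q x) mu *m P0.
  apply/matrixP => a b.
  have QfE i : Qf i a b = \sum_d P0 d i * (P0^T *m slot1 (Q x) d *m P0) a b.
    transitivity (slot1 Qf i a b); first by rewrite mxE.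
    rewrite /Qf move3E slot1_act3 summxE; apply: eq_bigr => d _.
    by rewrite !trmxK !mxE.
  rewrite mxE; under eq_bigr do rewrite QfE.
  exact: (sum_th mu (fun d => (P0^T *m slot1 (Q x) d *m P0) a b)).
have -> : slot1 (Q x) mu = \matrix_(a, b) dg mu a b - (Gmx mu)^T *m g x - g x *m Gmx mu.
  apply/matrixP => a b; rewrite !mxE /nonmetricity; congr (_ - _ - _).
    by apply: eq_bigr => l _; rewrite !mxE.
  by apply: eq_bigr => l _; rewrite !mxE mulrC.
rewrite trmx_mul [(- _)^T]raddfN /= !(mulmxBr, mulmxBl, mulmxDl, mulmxN, mulNmx) !mulmxA.
by rewrite [- _ + _]addrC.
Qed.

Lemma framed_metric_inv_derives mu : mx_derives (fun t => invmx (framed_metric mu t))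
  (- (minkowski *m (\matrix_(a, b) \sum_i th i mu * Qf i a b) *m minkowski)).
Proof.
have u : framed_metric mu 0 \in unitmx by rewrite framed_metric0 minkowski_unit.
by have := mx_derives_inv (framed_metric_derives mu) u;
  rewrite framed_metric0 invmx_minkowski.
Qed.

Local Notation Sp := (superpotential (g x) (Q x)).
Local Notation Spf := (superpotential minkowski Qf).
Local Notation N y := (diff_tensor (invmx (g y)) (Q y)).
Local Notation Nf := (diff_tensor minkowski Qf).

Lemma matrix_fun (F : tensor2 R) : fun_of_matrix (\matrix_(a, b) F a b) = F.
Proof. by apply/funext => a; apply/funext => b; rewrite mxE. Qed.

Lemma Sp_frame : Sp = act3 P0 P0 P0 Spf.
Proof. by rewrite (superpotential_act3 _ (g_unit Ux) P0_unit) P0_frame. Qed.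

Lemma N_frame : N x = act3 P0 th^T th^T Nf.
Proof. by rewrite (diff_tensor_act3 _ (g_unit Ux) P0_unit) P0_frame invmx_minkowski. Qed.

(** By naturality the field is the moving frame applied to its frame components, whose derivative is
    algebraic in [Qf] and [Sf]. *)
Lemma superpotential_field_derives mu :
  tensor_derives (fun t => superpotential (g (axis mu t)) (Q (axis mu t)))
    (fun a b c => gl_act3 (- Gmx mu) (- Gmx mu) (- Gmx mu) Sp a b c
      + \sum_i th i mu * act3 P0 P0 P0 (d_superpotential (Qf i) Qf (Sf i)) a b c).
Proof.
have hP := frame_derives mu.
have hQ := Qf_derives mu.
have := act3_derives_left hP hP hP
  (superpotential_derives (framed_metric0 mu) (framed_metric_inv_derives mu) hQ).
rewrite framed_metric0 frame0 axis0 -/Qf -Sp_frame matrix_fun => h a b c.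
(* The frame is known to be invertible, and the metric nondegenerate, only for small [t]; equality
   near 0 is enough for the derivative. *)
have near_eq : \forall t \near (0 : R),
    act3 (frame mu t) (frame mu t) (frame mu t)
      (superpotential (framed_metric mu t) (move3 (frame mu t)^T (Q (axis mu t)))) a b c
    = superpotential (g (axis mu t)) (Q (axis mu t)) a b c.
  apply: filterS2 (near_axis mu) (near_frame_unit mu) => t Ut Pt.
  by rewrite [in RHS](superpotential_act3 _ (g_unit Ut) Pt).
apply: (near_eq_is_derive near_eq); apply: (is_derive_eq (h a b c)).
congr (_ + _); under eq_bigr do rewrite act3Z.
rewrite act3_sum; congr (act3 _ _ _ _ _ _ _); do 3![apply/funext => ?].
exact: d_superpotential_sum.
Qed.

Lemma diff_tensor_field_derives mu :
  tensor_derives (fun t => N (axis mu t))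
    (fun a b c => gl_act3 (- Gmx mu) (Gmx mu)^T (Gmx mu)^T (N x) a b c
      + \sum_i th i mu * act3 P0 th^T th^T (d_disformation (Qf i) Qf (Sf i)) a b c).
Proof.
have hP := frame_derives mu.
have hT := frame_inv_derives mu.
have hQ := Qf_derives mu.
have I0 : invmx (framed_metric mu 0) =
  minkowski by rewrite framed_metric0 invmx_minkowski.
have := act3_derives_left hP hT hT
  (diff_tensor_derives (I := fun t => invmx (framed_metric mu t)) I0
    (framed_metric_inv_derives mu) hQ).
rewrite framed_metric0 frame0 axis0 -/Qf invmx_minkowski -N_frame matrix_fun => h a b c.
have near_eq : \forall t \near (0 : R),
    act3 (frame mu t) (invmx (frame mu t))^T (invmx (frame mu t))^T
      (diff_tensor (invmx (framed_metric mu t)) (move3 (frame mu t)^T (Q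
        (axis mu t)))) a b c
    = N (axis mu t) a b c.
  apply: filterS2 (near_axis mu) (near_frame_unit mu) => t Ut Pt.
  by rewrite [in RHS](diff_tensor_act3 _ (g_unit Ut) Pt).
apply: (near_eq_is_derive near_eq); apply: (is_derive_eq (h a b c)).
congr (_ + _); under eq_bigr do rewrite act3Z.
rewrite act3_sum; congr (act3 _ _ _ _ _ _ _); do 3![apply/funext => ?].
exact: d_disformation_sum.
Qed.

(** * Divergence of the momentum density *)

Lemma vol_field_derives mu :
  is_derive (0 : R) 1 (fun t => vol (g (axis mu t)))
    (vol (g x) * (2^-1 * trace23 (invmx (g x)) (Q x) mu + \tr (Gmx mu))).
Proof.
have hg i j : is_derive (0 : R) 1 (fun t => g (axis mu t) i j) ((\matrix_(a,
  b) dg mu a b) i j).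
  by rewrite mxE; exact: (axis_derive mu (g_diff i j)).
have d0 : \det (g (axis mu 0)) < 0.
  by rewrite axis0; exact: det_lorentz_neg P0_unit P0_frame.
apply: (is_derive_eq (is_derive_vol hg d0)); rewrite axis0; congr (_ * _).
have gT : (g x)^T = g x by have [] := g_lorentz Ux.
have -> : \matrix_(a, b) dg mu a b = slot1 (Q x) mu + (Gmx mu)^T *m g x + g x *m Gmx mu.
  apply/matrixP => a b; rewrite !mxE /nonmetricity.
  have -> : \sum_j (Gmx mu)^T a j * g x j b = \sum_j G j a mu * g x j b.
    by apply: eq_bigr => j _; rewrite !mxE.
  have -> : \sum_j g x a j * Gmx mu j b = \sum_j G j b mu * g x a j.
    by apply: eq_bigr => j _; rewrite !mxE mulrC.
  by ring.
have gu := g_unit Ux.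
have E : \tr (g x *m Gmx mu *m invmx (g x)) = \tr (Gmx mu).
  by rewrite mxtrace_mulC mulmxA mulVmx // mul1mx.
rewrite !mulmxDl !mxtraceD mulmxK // mxtrace_tr E.
rewrite trace23E trmx_inv gT [\tr (slot1 _ _ *m _)]mxtrace_mulC.
by field.
Qed.

Lemma density_divergence_frame (k : R) a b :
  density_divergence Gam (fun y => fun r m v => k * vol (g y) * superpotential (g y)
    (Q y) r m v) x a b
  = k * vol (g x) * move2 P0 (fun m v =>
      \sum_i d_superpotential (Qf i) Qf (Sf i) i m v
        + 2^-1 * \sum_i ftrace23 Qf i * Spf i m v) a b.
Proof.
have dP mu r m v : partial mu
  (fun y => k * vol (g y) * superpotential (g y) (Q y) r m v) x
   = k * vol (g x) * ((2^-1 * trace23 (invmx (g x)) (Q x) mu + \tr (Gmx mu)) * Sp r m v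
     + (gl_act3 (- Gmx mu) (- Gmx mu) (- Gmx mu) Sp r m v
      + \sum_i th i mu * act3 P0 P0 P0 (d_superpotential (Qf i) Qf (Sf i)) r m v)).
  apply: partial_axis.
  apply: (is_derive_eq (is_derive_mul (is_derive_scale k (vol_field_derives mu))
    (superpotential_field_derives mu r m v))).
  by rewrite axis0; ring.
(* Zero torsion is what identifies the weight term with the connection term of the contracted
   index. *)
have trG mu : \tr (Gmx mu) = \sum_r G r mu r.
  by apply: eq_bigr => r _; rewrite mxE (Gam_sym Ux).
have Z1 : \sum_r trace23 (invmx (g x)) (Q x) r * Sp r a b =
    move2 P0 (fun m v => \sum_i ftrace23 Qf i * Spf i m v) a b.
  have QE : Q x = act3 th^T th^T th^T Qf.
    rewrite /Qf move3E act3_comp -trmx_mul mulmxV // trmx1 act3_1 //.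
  have E : trace23 (invmx (g x)) (Q x) = move1 th^T (ftrace23 Qf).
    rewrite {1}QE trace23_act3 trmxK trmx_inv -invmx_congr ?g_unit // P0_frame
      invmx_minkowski.
    by congr move1; apply/funext => i; rewrite trace23_minkowski.
  rewrite E Sp_frame contract_act3 move1_comp -trmx_mul mulVmx // trmx1.
  by congr (move2 _ _ _ _); do 2![apply/funext => ?]; rewrite move1_1.
have Z2 : \sum_r \sum_i th i r * act3 P0 P0 P0 (d_superpotential (Qf i) Qf (Sf i)) r a b =
    move2 P0 (fun m v => \sum_i d_superpotential (Qf i) Qf (Sf i) i m v) a b.
  rewrite exchange_big /= -move2_sum; apply: eq_bigr => i _.
  by rewrite contract1_act3 mulVmx // act3_1l.
rewrite /density_divergence.
under eq_bigr do rewrite dP.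
rewrite -move2D -move2Z -Z2 -Z1.
have -> (s : tensor3 R) : \sum_r \sum_l G a l r * (k * vol (g x) * s r l b) =
    k * vol (g x) * \sum_r \sum_l G a l r * s r l b.
  rewrite mulr_sumr; apply: eq_bigr => r _; rewrite mulr_sumr; apply: eq_bigr => l _.
  by rewrite mulrCA.
have -> (s : tensor3 R) : \sum_r \sum_l G b l r * (k * vol (g x) * s r a l) =
    k * vol (g x) * \sum_r \sum_l G b l r * s r a l.
  rewrite mulr_sumr; apply: eq_bigr => r _; rewrite mulr_sumr; apply: eq_bigr => l _.
  by rewrite mulrCA.
rewrite -mulr_sumr -!mulrDr; congr (_ * _).
have gl3E' r : gl_act3 (- Gmx r) (- Gmx r) (- Gmx r) Sp r a b =
  - \sum_d G r d r * Sp d a b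
    - \sum_d G a d r * Sp r d b - \sum_d G b d r * Sp r a d.
  rewrite /gl_act3 -!sumrN; congr (_ + _ + _); apply: eq_bigr => d _;
    by rewrite !mxE mulNr.
under eq_bigr do rewrite gl3E' trG.
exact: (divergence_algebra G Sp (trace23 (invmx (g x)) (Q x))).
Qed.

(** * Levi-Civita curvature relative to the flat connection *)

Lemma christoffelE y : U y -> forall a b c,
  christoffel g y a b c = Gam y a b c + N y a b c.
Proof.
move=> Uy a b c.
have inner l : 2^-1 * (partial b (fun y => g y l c) y + partial c (fun y => g y l b) y
     - partial l (fun y => g y b c) y) =
   disformation (Q y) l b c + move1 (g y) (fun k => Gam y k b c) l.
  exact: (christoffel_algebra (fun c a b => partial c
    (fun y => g y a b) y) (Gam_sym Uy) (g_sym Uy)).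
rewrite /christoffel mulr_sumr /diff_tensor act3_left.
under eq_bigr do rewrite mulrCA inner mulrDr.
rewrite big_split addrC /=; congr (_ + _).
rewrite -/(move1 _ _ a) move1_comp mulVmx ?g_unit // move1_1 //.
Qed.

(** The covariant derivative nabla_mu N^a_{bc}, transported back from the frame. *)
Definition DN mu : tensor3 R := fun a b c =>
  \sum_i th i mu * act3 P0 th^T th^T (d_disformation (Qf i) Qf (Sf i)) a b c.

Lemma partial_christoffel mu a b c : partial mu (fun y => christoffel g y a b c) x =
  partial mu (fun y => Gam y a b c) x + (- \sum_d G a d mu * N x d b c
   + \sum_d G d b mu * N x a d c + \sum_d G d c mu * N x a b d + DN mu a b c).
Proof.
rewrite {1}/partial (near_eq_derive (g := fun y => Gam y a b c + N y a b c)).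
  apply: partial_axis.
  apply: (is_derive_eq (is_derive_add (axis_derive mu (Gam_diff a b c))
    (diff_tensor_field_derives mu a b c))).
  rewrite /gl_act3 /DN -sumrN; congr (_ + (_ + _ + _ + _)); apply: eq_bigr => d _.
  - by rewrite !mxE mulNr.
  - by rewrite !mxE.
  - by rewrite !mxE.
apply: near_x => y Uy; exact: christoffelE.
Qed.

Lemma curvature_christoffel a b m n : curvature (christoffel g) x a b m n =
  DN m a b n - DN n a b m + \sum_l N x a l m * N x l b n - \sum_l N x a l n * N x l b m.
Proof.
have := Gam_flat a b m n; rewrite /curvature !partial_christoffel => flat0.
have E m' n' : \sum_l christoffel g x a l m' * christoffel g x l b n' =
    \sum_l (G a l m' + N x a l m') * (G l b n' + N x l b n').
  by apply: eq_bigr => l _; rewrite !(christoffelE Ux).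
rewrite !E.
rewrite (curvature_algebra (N x) (fun m a b c => partial m
  (fun y => Gam y a b c) x) DN (Gam_sym Ux)).
by rewrite flat0 add0r.
Qed.

Lemma NfE a b c : Nf a b c = mink a * disformation Qf a b c.
Proof. by rewrite /diff_tensor act3_left (sum_minkowski a
  (fun d => disformation Qf d b c)). Qed.

Lemma ricci_frame s v : ricci g x s v = move2 th^T (frame_ricci Qf Sf) s v.
Proof.
rewrite /ricci; under eq_bigr do rewrite curvature_christoffel.
rewrite !sumrB big_split /= sumrB.
have thP : th *m P0 = 1%:M by exact: mulVmx.
have PtT : P0^T *m th^T = 1%:M by rewrite -trmx_mul mulVmx // trmx1.
have T1 : \sum_r DN r r s v =
    move2 th^T (fun s v => \sum_r d_disformation (Qf r) Qf (Sf r) r s v) s v.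
  rewrite exchange_big /= -move2_sum; apply: eq_bigr => i _.
  by rewrite contract1_act3 thP act3_1l.
(* Contracting an upper with a lower index is a trace against the identity matrix, so [trace13_act3]
   applies and frame and coframe cancel. *)
have tr1 Y r : trace13 1%:M Y r = \sum_k Y k r k.
  apply: eq_bigr => l _; rewrite (bigD1 l) //= big1 => [|k kl].
    by rewrite mxE eqxx mul1r addr0.
  by rewrite mxE eq_sym (negbTE kl) mul0r.
have trA Y : trace13 1%:M (act3 P0 th^T th^T Y) = move1 th^T (fun r => \sum_k Y k r k).
  rewrite trace13_act3 mulmx1 PtT; congr move1; apply/funext => r; exact: tr1.
have T2 : \sum_r DN v r s r =
    move2 th^T (fun s v => \sum_r d_disformation (Qf v) Qf (Sf v) r s r) s v.
  rewrite [LHS]exchange_big /move2 [RHS]exchange_big /=; apply: eq_bigr => i _.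
  rewrite -mulr_sumr -tr1 trA /move1 mulr_sumr; apply: eq_bigr => j _.
  by rewrite !mxE mulrCA mulrA.
have T3 : \sum_r \sum_l N x r l r * N x l s v =
    move2 th^T (fun s v => \sum_r \sum_l mink r * disformation Qf r l r *
      (mink l * disformation Qf l s v)) s v.
  rewrite exchange_big /=; under eq_bigr do rewrite -mulr_suml -tr1.
  rewrite N_frame trA contract_act3 move1_comp PtT move1_1.
  congr (move2 _ _ _ _); apply/funext => i; apply/funext => j.
  rewrite exchange_big; apply: eq_bigr => l _ /=; rewrite mulr_suml.
  by apply: eq_bigr => r _; rewrite !NfE.
have T4 : \sum_r \sum_l N x r l v * N x l s r =
    move2 th^T (fun s v => \sum_r \sum_l mink r * disformation Qf r l v *
      (mink l * disformation Qf l s r)) s v.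
  (* Exchanging the lower slots of the first factor puts [v] in the middle, so the double
     contraction is the trace of a product of two slices. *)
  rewrite (contract_slot22 (fun a b c => N x a c b)).
  have -> : (fun a b c => N x a c b) = act3 P0 th^T th^T (fun a b c => Nf a c b).
    by apply/funext => a; apply/funext => b; apply/funext => c;
      rewrite N_frame act3_swap23.
  rewrite N_frame !slot2_act3 mulmx_suml raddf_sum move2_tr /move2 /=.
  apply: eq_bigr => i _; rewrite mulmx_sumr raddf_sum; apply: eq_bigr => j _ /=.
  rewrite -scalemxAl -scalemxAr !mxtraceZ trmxK mulrA; congr (_ * _).
  rewrite -!mulmxA (mulmxA th P0) thP mul1mx mxtrace_mulC -!mulmxA thP mulmx1.
  rewrite -contract_slot22; apply: eq_bigr => r _; apply: eq_bigr => l _.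
  by rewrite !NfE.
rewrite T1 T2 T3 T4 !move2N !move2D.
by congr (move2 _ _ _ _); apply/funext => i; apply/funext => j.
Qed.

Lemma einstein_frame a b : einstein_up g x a b =
  move2 P0 (fun m v => mink m * mink v * frame_ricci Qf Sf m v
    - 2^-1 * frame_metric m v * \sum_i mink i * frame_ricci Qf Sf i i) a b.
Proof.
have gu := g_unit Ux.
have giE : invmx (g x) = P0 *m minkowski *m P0^T.
  rewrite -invmx_minkowski -P0_frame invmx_congr // !mulmxA mulmxV // mul1mx mulmxKV //.
  by rewrite unitmx_tr.
have scE : scalar_curvature g x = \sum_i mink i * frame_ricci Qf Sf i i.
  transitivity (\tr ((invmx (g x))^T *m \matrix_(m, v) ricci g x m v)).
    rewrite /scalar_curvature exchange_big; apply: eq_bigr => v _ /=.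
    by rewrite mxE; apply: eq_bigr => m _; rewrite !mxE.
  have -> : \matrix_(m, v) ricci g x m v = th^T *m (\matrix_(m,
    v) frame_ricci Qf Sf m v) *m th.
    by apply/matrixP => m v; rewrite mxE ricci_frame move2E trmxK.
  rewrite giE !trmx_mul trmxK minkowski_tr.
  have thP : th *m P0 = 1%:M by exact: mulVmx.
  have PtT : P0^T *m th^T = 1%:M by rewrite -trmx_mul mulVmx // trmx1.
  rewrite !mulmxA mxtrace_mulC !mulmxA thP mul1mx -[X in \tr (X *m _)]mulmxA PtT mulmx1.
  by apply: eq_bigr => i _; rewrite mxE (sum_minkowski i (fun j => (\matrix_(m,
    v) frame_ricci Qf Sf m v) j i)) mxE.
have eE : einstein g x = fun m v => move2 th^T (fun m v => frame_ricci Qf Sf m v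
     - 2^-1 * frame_metric m v * \sum_i mink i * frame_ricci Qf Sf i i) m v.
  apply/funext => m; apply/funext => v; rewrite /einstein scE ricci_frame.
  have -> : g x = th^T *m minkowski *m th^T^T.
    rewrite -P0_frame trmxK !mulmxA -trmx_mul mulmxV // trmx1 mul1mx mulmxK //.
  rewrite move2_mx -mulrA [move2 _ _ _ _ * _]mulrC !move2Z move2N move2D.
  congr (move2 _ _ _ _); apply/funext => i; apply/funext => j.
  by rewrite minkowskiE; ring.
rewrite /einstein_up eE giE move2_comp.
have -> : P0 *m minkowski *m P0^T *m th^T = P0 *m minkowski.
  by rewrite -mulmxA -trmx_mul mulVmx // trmx1 mulmx1.
rewrite -move2_comp; congr (move2 _ _ _ _); apply/funext => i; apply/funext => j.
rewrite /move2; under eq_bigr => k _.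
  under eq_bigr => l _ do rewrite -mulrA.
  rewrite -mulr_sumr sum_minkowski.
  over.
rewrite sum_minkowski /=; set z := \sum_i0 _.
(* Raising both indices of the Minkowski metric returns the same array, as the signs square to 1 on
   the diagonal. *)
have E : mink i * mink j * frame_metric i j = frame_metric i j :> R.
  rewrite /frame_metric eqb_ord; case: eqP => [->|_]; last by rewrite mulr0.
  by rewrite mink_sq mul1r.
by rewrite -[in RHS]E; ring.
Qed.

(** * Assembling the first identity at a point *)

Lemma Qf_sym a b c : Qf a b c = Qf a c b.
Proof.
rewrite /Qf move3E act3_swap23; congr (act3 _ _ _ _ _ _ _).
by do 3![apply/funext => ?]; rewrite (Q_sym Ux).
Qed.

Lemma Sf_sym23 i a b c : Sf i a b c = Sf i a c b.
Proof.
apply: eq_bigr => d _; congr (_ * _).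
rewrite move3E act3_swap23; congr (act3 _ _ _ _ _ _ _).
by do 3![apply/funext => ?]; rewrite covQ_sym23.
Qed.

(** The frame form of [covQ_comm], and the only place where flatness enters the frame identity. *)
Lemma Sf_comm i j a b : Sf i j a b = Sf j i a b.
Proof.
have E i' j' : Sf i' j' a b = \sum_d \sum_e P0 d i' * P0 e j' *
    \sum_f \sum_h P0 f a * P0 h b * covQ d e f h.
  apply: eq_bigr => d _; rewrite mulr_sumr; apply: eq_bigr => e _.
  rewrite !mulr_sumr; apply: eq_bigr => f _; rewrite !mulr_sumr; apply: eq_bigr => h _.
  by rewrite !mxE; ring.
rewrite !E exchange_big; apply: eq_bigr => e _; apply: eq_bigr => d _ /=.
rewrite [P0 d i * _]mulrC; congr (_ * _).
by apply: eq_bigr => f _; apply: eq_bigr => h _; rewrite covQ_comm.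
Qed.

Lemma einstein_superpotential a b : einstein_up g x a b =
  move2 P0 (fun m v => \sum_i d_superpotential (Qf i) Qf (Sf i) i m v
    + 2^-1 * \sum_i ftrace23 Qf i * Spf i m v) a b
  + 4 * stegr_potential Sp (g x) a b.
Proof.
rewrite einstein_frame Sp_frame (stegr_potential_act3 _ _ _ (g_unit Ux) P0_unit) P0_frame.
rewrite move2Z move2D; congr (move2 _ _ _ _); apply/funext => m; apply/funext => v.
exact: (frame_identity m v Qf_sym Sf_sym23 Sf_comm).
Qed.

Lemma stegr_einstein_identity kappa a b : kappa != 0 ->
  let Pi := stegr_momentum kappa Gam g in
  vol (g x) * einstein_up g x a b
  = - (kappa ^+ 2 / 2) * density_divergence Gam Pi x a b
    + kappa ^+ 4 / vol (g x) * stegr_potential (Pi x) (g x) a b.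
Proof.
move=> k0 Pi; have v0 : vol (g x) != 0.
  by rewrite gt_eqF // sqrtr_gt0 oppr_gt0; exact: det_lorentz_neg P0_unit P0_frame.
(* The constant is separated from the volume, which depends on the point and is differentiated by
   [density_divergence_frame]. *)
have PiE : Pi = fun y r m v => - (2 / kappa ^+ 2) * vol (g y) * superpotential (g y)
  (Q y) r m v.
  do 4![apply/funext => ?]; rewrite /Pi /stegr_momentum; congr (_ * _).
  by rewrite mulrAC !mulNr.
rewrite PiE density_divergence_frame stegr_potential_scale einstein_superpotential.
by field; rewrite k0 v0.
Qed.

End Fields.

(** * The theorem in a chart of the manifold *)

Unset Implicit Arguments.

Theorem mainTheorem3 (R : realType) (kappa : R) (hkappa : 0 < kappa ^+ 2)
    (X : topologicalType) (M : manifold4 R X)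
    (nabla : connection M) (hflat : flat nabla) (htorsion : torsionless nabla)
    (metric : lorentz_metric M)
    (i : chart_index M) (x : 'rV[R]_4) (hx : chart_cod i x) :
  let Gam := connection_coef nabla i in
  let g := metric_coef metric i in
  let Pi := stegr_momentum kappa Gam g in
  (forall mu nu : 'I_4,
     vol (g x) * einstein_up g x mu nu
     = - (kappa ^+ 2 / 2) * density_divergence Gam Pi x mu nu
       + kappa ^+ 4 / vol (g x) * stegr_potential (Pi x) (g x) mu nu)
  /\
  exists D : 'M[R]_4,
    [/\ is_metric_derivative
          (fun h : 'M[R]_4 => stegr_hamiltonian kappa h (Pi x)) (g x) D,
        forall mu nu : 'I_4,
          density_divergence Gam Pi x mu nu + D mu nu
          = - (2 / kappa ^+ 2) * vol (g x) * einstein_up g x mu nu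
      & (forall mu nu : 'I_4,
           density_divergence Gam Pi x mu nu = - D mu nu)
        <-> (forall mu nu : 'I_4, einstein g x mu nu = 0)].
Proof.
move=> Gam g Pi.
have Uo : open (chart_cod i) by exact: chart_cod_open.
have gL y : chart_cod i y -> lorentzian (g y) by exact: metric_lorentzian.
have [gT [P0 [P0u P0f]]] := gL x hx; rewrite -/minkowski in P0f.
have gN : \det (g x) < 0 by exact: det_lorentz_neg P0u P0f.
have gu : g x \in unitmx by rewrite unitmxE unitfE lt_eqF.
have v0 : vol (g x) != 0 by rewrite gt_eqF // sqrtr_gt0 oppr_gt0.
have k0 : kappa != 0 by apply: contraTneq hkappa => ->; rewrite expr0n ltxx.
have gsm a b := @metric_smooth _ _ _ metric i a b.
have Gsm a b c := @connection_smooth _ _ _ nabla i a b c.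
have identity mu nu : vol (g x) * einstein_up g x mu nu
     = - (kappa ^+ 2 / 2) * density_divergence Gam Pi x mu nu
       + kappa ^+ 4 / vol (g x) * stegr_potential (Pi x) (g x) mu nu.
  (* The analytic hypotheses are instances of smoothness for short lists of derivatives, and the
     last is Schwarz's theorem. *)
  apply: (stegr_einstein_identity Uo hx gL (htorsion i) _ _ _ _ _ P0u P0f mu nu k0).
  - exact: (hflat i x hx).
  - by move=> a b c; exact: (Gsm a b c [::] x hx).
  - by move=> a b; exact: (gsm a b [::] x hx).
  - by move=> d a b; exact: (gsm a b [:: d] x hx).
  - by move=> c d a b; exact: (partial_comm c d Uo hx (gsm a b)).
split; first exact: identity.
have PiS a b c : Pi x a b c = Pi x a c b.
  rewrite /Pi /stegr_momentum; congr (_ * _).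
  by apply: superpotential_sym => // *; exact: (Q_sym Gam Uo gL hx).
exists (\matrix_(m, n) (- (2 * kappa ^+ 2 / vol (g x)) * stegr_potential (Pi x)
  (g x) m n)).
(* The first identity multiplied by -2 / kappa^2. *)
have second mu nu : density_divergence Gam Pi x mu nu +
     (\matrix_(m, n) (- (2 * kappa ^+ 2 / vol (g x)) * stegr_potential (Pi x)
       (g x) m n)) mu nu
     = - (2 / kappa ^+ 2) * vol (g x) * einstein_up g x mu nu.
  rewrite -[RHS]mulrA identity mxE; field.
  by rewrite v0 k0.
split=> //; first exact: stegr_metric_derivative.
split=> [H mu nu|H mu nu].
  (* The field equation annihilates the left side of [second], whose right side has a nonzero factor
     in front of the Einstein tensor; lowering both indices with [g x] then gives the covariant
     components. *)
  have up0 : einstein_up g x = fun _ _ => 0.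
    apply/funext => m; apply/funext => n; have := second m n.
    rewrite H addNr => /esym/eqP; rewrite !mulf_eq0 oppr_eq0 !mulf_eq0 invr_eq0.
    by rewrite expf_eq0 (negbTE k0) (negbTE v0) pnatr_eq0 /= => /eqP.
  have -> : einstein g x = move2 (g x) (einstein_up g x).
    rewrite /einstein_up move2_comp mulmxV //.
    apply/funext => m; apply/funext => n.
    by rewrite move2E mul1mx trmx1 mulmx1 mxE.
  by rewrite up0 /move2 big1 // => c _; rewrite big1 // => d _; rewrite mulr0.
apply/eqP; rewrite -addr_eq0 second.
have -> : einstein_up g x mu nu = 0.
  by rewrite /einstein_up /move2 big1 // => c _; rewrite big1 // => d _; rewrite H mulr0.
by rewrite mulr0.
Qed.
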